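(* Let $\mathbf{g}: M^2\to \mathbb{S}^5$ be a minimal isometric immersion of a 2-dimensional manifold whose second fundamental form is nowhere zero. Let $\mathcal{N}$ be the unit normal bundle of $\mathbf{g}$, let $\mathbf{x}_{\mathbf{g}}:\mathcal{N}\to\mathbb{S}^5$, $\mathbf{x}_{\mathbf{g}}(p,V)=V$, and let $\mathcal{N}_*\subset\mathcal{N}$ be the subset of those $(p,V)\in\mathcal{N}$ such that $V$ is not orthogonal to $\mathbf{B}_p(T_pM)$. Then $\mathcal{N}_*$ is an open set of $\mathcal{N}$ such that $\mathbf{x}_{\mathbf{g}}:\mathcal{N}_*\to\mathbb{S}^5$ is an immersion of the 4-dimensional manifold $\mathcal{N}_*$. Furthermore, $\mathbf{x}_{\mathbf{g}}:\mathcal{N}_*\to\mathbb{S}^5$ is an immersed minimal hypersurface of $\mathbb{S}^5$ with zero Gauss-Kronecker curvature and zero 3-mean curvature.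
   Context: $\mathbb{S}^5\subset\mathbb{R}^6$ is the unit sphere. The second fundamental form of $\mathbf{g}$ at $p$ is the symmetric bilinear map $\mathbf{B}_p: T_pM\times T_pM\to (\mathbf{g}_*(T_pM))^\perp$ with values in the normal space $(\mathbf{g}_*(T_pM))^\perp\subset T_{\mathbf{g}(p)}\mathbb{S}^5$ (3-dimensional); $\mathbf{g}$ is minimal if the trace of $\mathbf{B}$ vanishes. $\mathbf{B}_p(T_pM)$ denotes the linear span of all vectors $\mathbf{B}_p(X,Y)$, $X,Y\in T_pM$. Unit normal bundle: $\mathcal{N}=\{(p,V)\in M^2\times\mathbb{R}^6:\ \|V\|=1,\ V\perp \mathbb{R}\cdot\mathbf{g}(p)\oplus\mathbf{g}_*(T_pM)\}$, with fibre $\mathcal{N}(p)$ over $p$. In terms of fibres, $\mathcal{N}_*(p)=\mathcal{N}(p)\setminus\left(\mathbf{B}_p(T_pM)^\perp\cap \mathbf{g}_*(T_pM)^\perp\right)$. For an immersed hypersurface $N^4\to\mathbb{S}^5$ with principal curvatures $\lambda_1,\dots,\lambda_4$ (with respect to a local unit normal field), the $r$-mean curvature is $H_r=\binom{4}{r}^{-1}\sum_{i_1<\cdots<i_r}\lambda_{i_1}\cdots\lambda_{i_r}$. Here $H_1$ is the mean curvature (the hypersurface is minimal if $H_1=0$) and $H_4=\lambda_1\lambda_2\lambda_3\lambda_4$ is the Gauss-Kronecker curvature. *)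

(* Defs.v *)
(* Everything is over an arbitrary realType R, and smooth means C^infinity.

   R^m is 'rV[R]_m.  Its library norm is the sup norm, which only supplies the
   topology and the differential calculus; every metric notion below goes
   through the Euclidean inner product [dot].  Linear maps act on row vectors
   from the right, so the rows of 'J f u span the image of the differential. *)
From HB Require Import structures.
From mathcomp Require Import all_boot all_order all_algebra.
From mathcomp Require Import all_classical all_reals all_analysis.

Set Implicit Arguments.
Unset Strict Implicit.
Unset Printing Implicit Defensive.

Import Order.TTheory GRing.Theory Num.Theory.
Import numFieldNormedType.Exports.

Local Open Scope classical_set_scope.
Local Open Scope ring_scope.

Definition dot (R : realType) (m : nat) (v w : 'rV[R]_m) : R :=
  (v *m w^T) 0 0.

(* The sphere of dimension m - 1. *)
Definition unit_sphere (R : realType) (m : nat) : set 'rV[R]_m :=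
  [set v | dot v v = 1].

Definition linear_span (R : realType) (m : nat) (S : set 'rV[R]_m) :
    set 'rV[R]_m :=
  [set w | exists (k : nat) (a : 'I_k -> R) (v : 'I_k -> 'rV[R]_m),
     (forall i, S (v i)) /\ w = \sum_i a i *: v i].

(* Class C^k on an open set U; values of f outside U are irrelevant. *)
Fixpoint Ck_on (R : realType) (V W : normedModType R) (k : nat) (U : set V)
    (f : V -> W) : Prop :=
  if k is k'.+1 then
    (forall x, U x -> differentiable f x) /\
    (forall v : V, Ck_on k' U (fun x => 'D_v f x))
  else forall x, U x -> {for x, continuous f}.

Definition smooth_on (R : realType) (V W : normedModType R) (U : set V)
    (f : V -> W) : Prop :=
  forall k, Ck_on k U f.

(* A chart and the local parametrization inverse to it, both extended by
   arbitrary values outside their domains [dom] and [cod]. *)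
Record chart (R : realType) (n : nat) (T : topologicalType) := Chart {
  dom : set T;
  cod : set 'rV[R]_n;
  coord :> T -> 'rV[R]_n;
  param : 'rV[R]_n -> T
}.

(* c is a homeomorphism from a relatively open subset of A onto an open subset
   of R^n. *)
Definition chart_of (R : realType) (n : nat) (T : topologicalType)
    (A : set T) (c : chart R n T) : Prop :=
  [/\ exists2 O : set T, open O & dom c = A `&` O,
      open (cod c),
      (forall p, dom c p -> cod c (c p) /\ param c (c p) = p),
      (forall u, cod c u -> dom c (param c u) /\ c (param c u) = u) &
      {within dom c, continuous c} /\ {within cod c, continuous (param c)}].

Definition smooth_manifold (R : realType) (n : nat) (M : topologicalType)
    (atlas : set (chart R n M)) : Prop :=
  [/\ hausdorff_space M /\ @second_countable M,
      forall c, atlas c -> chart_of setT c,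
      forall p : M, exists2 c, atlas c & dom c p &
      forall c c', atlas c -> atlas c' ->
        smooth_on (cod c `&` param c @^-1` dom c') (c' \o param c)].

(* The matrix h c u is the Gram matrix, in the coordinate frame of the chart c,
   of the inner product on the tangent space at param c u. *)
Definition riemannian_metric (R : realType) (n : nat) (M : topologicalType)
    (atlas : set (chart R n M)) (h : chart R n M -> 'rV[R]_n -> 'M[R]_n) :
    Prop :=
  [/\ forall c, atlas c -> smooth_on (cod c) (h c),
      forall c u, atlas c -> cod c u -> (h c u)^T = h c u,
      forall c u (xi : 'rV[R]_n), atlas c -> cod c u -> xi != 0 ->
        0 < (xi *m h c u *m xi^T) 0 0 &
      forall c c' u, atlas c -> atlas c' -> cod c u -> dom c' (param c u) ->
        h c u = 'J (c' \o param c) u *m h c' (c' (param c u))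
                  *m ('J (c' \o param c) u)^T].

(* F is only used on A, the set covered by the charts.  A map into the sphere
   is smooth, resp. an immersion, iff it is so as a map into R^m. *)
Definition sphere_immersion (R : realType) (n m : nat) (T : topologicalType)
    (A : set T) (charts : set (chart R n T)) (F : T -> 'rV[R]_m) : Prop :=
  [/\ forall p, A p -> unit_sphere (F p),
      forall c, charts c -> smooth_on (cod c) (F \o param c) &
      forall c u, charts c -> cod c u -> row_free ('J (F \o param c) u)].

(* The first fundamental form of a local parametrization f. *)
Definition first_form (R : realType) (n m : nat) (f : 'rV[R]_n -> 'rV[R]_m)
    (u : 'rV[R]_n) : 'M[R]_n :=
  'J f u *m ('J f u)^T.

Definition isometric (R : realType) (n m : nat) (M : topologicalType)
    (atlas : set (chart R n M)) (h : chart R n M -> 'rV[R]_n -> 'M[R]_n)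
    (g : M -> 'rV[R]_m) : Prop :=
  forall c u, atlas c -> cod c u -> h c u = first_form (g \o param c) u.

(* Orthogonal projection of R^m along the row space of A: the rows w with
   w *m A^T = 0 form the orthogonal complement of that row space. *)
Definition normal_proj (R : realType) (k m : nat) (A : 'M[R]_(k, m)) :
    'M[R]_m :=
  proj_mx (kermx A^T) <<A>>%MS.

(* Second fundamental form, in the sphere, of a local parametrization f:
   the component of the flat second derivative orthogonal to the position
   vector f u and to the tangent space. *)
Definition second_form (R : realType) (n m : nat) (f : 'rV[R]_n -> 'rV[R]_m)
    (u xi eta : 'rV[R]_n) : 'rV[R]_m :=
  'D_xi (fun x => 'D_eta f x) u *m normal_proj (col_mx (f u) ('J f u)).

Definition minimal_immersion (R : realType) (n m : nat) (M : topologicalType)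
    (atlas : set (chart R n M)) (h : chart R n M -> 'rV[R]_n -> 'M[R]_n)
    (g : M -> 'rV[R]_m) : Prop :=
  forall c u, atlas c -> cod c u ->
    \sum_i \sum_j invmx (h c u) i j *:
      second_form (g \o param c) u (delta_mx 0 i) (delta_mx 0 j) = 0.

Section UnitNormalBundle.
Variables (R : realType) (n m : nat) (M : topologicalType).
Variables (atlas : set (chart R n M)) (g : M -> 'rV[R]_m).

(* g_*(T_pM) *)
Definition tangent_image (p : M) : set 'rV[R]_m :=
  [set w | exists c (xi : 'rV[R]_n),
     [/\ atlas c, dom c p & w = 'd (g \o param c) (c p) xi]].

(* The vectors B_p(X, Y), for X, Y in T_pM *)
Definition second_form_values (p : M) : set 'rV[R]_m :=
  [set w | exists c (xi eta : 'rV[R]_n),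
     [/\ atlas c, dom c p & w = second_form (g \o param c) (c p) xi eta]].

Definition unit_normal_bundle : set (M * 'rV[R]_m) :=
  [set q | [/\ dot q.2 q.2 = 1, dot q.2 (g q.1) = 0 &
               forall w, tangent_image q.1 w -> dot q.2 w = 0]].

Definition unit_normal_bundle_star : set (M * 'rV[R]_m) :=
  [set q | unit_normal_bundle q /\
     ~ (forall w, linear_span (second_form_values q.1) w -> dot q.2 w = 0)].

End UnitNormalBundle.

Definition xg (R : realType) (m : nat) (M : topologicalType)
    (q : M * 'rV[R]_m) : 'rV[R]_m := q.2.

(* The charts of A as a submanifold of M * R^m: those whose inverse is a smooth
   immersion into the product manifold. *)
Definition submanifold_charts (R : realType) (n m d : nat)
    (M : topologicalType) (atlas : set (chart R n M))
    (A : set (M * 'rV[R]_m)) : set (chart R d (M * 'rV[R]_m)%type) :=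
  [set c | chart_of A c /\
     forall b, atlas b ->
       let U := cod c `&` [set u | dom b (param c u).1] in
       let Y u := row_mx (b (param c u).1) (param c u).2 in
       smooth_on U Y /\ (forall u, U u -> row_free ('J Y u))].

Arguments submanifold_charts {R n m} d {M} atlas A.

Definition embedded_submanifold (R : realType) (n m d : nat)
    (M : topologicalType) (atlas : set (chart R n M))
    (A : set (M * 'rV[R]_m)) : Prop :=
  forall q, A q -> exists2 c, submanifold_charts d atlas A c & dom c q.

Definition unit_normal_field (R : realType) (n m : nat)
    (f : 'rV[R]_n -> 'rV[R]_m) (U : set 'rV[R]_n) (nu : 'rV[R]_n -> 'rV[R]_m) :
    Prop :=
  smooth_on U nu /\
  forall u, U u ->
    [/\ dot (nu u) (nu u) = 1, dot (nu u) (f u) = 0 &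
        forall xi : 'rV[R]_n, dot (nu u) ('d f u xi) = 0].

(* Matrix S of the shape operator xi |-> xi *m S in the coordinate frame, given
   by <S xi, eta> = <B(xi, eta), nu>. *)
Definition shape_operator (R : realType) (n m : nat)
    (f : 'rV[R]_n -> 'rV[R]_m) (u : 'rV[R]_n) (nu : 'rV[R]_m) : 'M[R]_n :=
  (\matrix_(i, j) dot (second_form f u (delta_mx 0 i) (delta_mx 0 j)) nu)
    *m invmx (first_form f u).

(* lam lists the eigenvalues of the shape operator with multiplicity. *)
Definition principal_curvatures (R : realType) (n m : nat)
    (f : 'rV[R]_n -> 'rV[R]_m) (u : 'rV[R]_n) (nu : 'rV[R]_m)
    (lam : 'I_n -> R) : Prop :=
  char_poly (shape_operator f u nu) = \prod_i ('X - (lam i)%:P).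

(* "H_r = H at u".  The principal curvatures exist and are unique up to order,
   so this holds for exactly one H. *)
Definition r_mean_curvature (R : realType) (n m : nat)
    (f : 'rV[R]_n -> 'rV[R]_m) (u : 'rV[R]_n) (nu : 'rV[R]_m) (r : nat)
    (H : R) : Prop :=
  exists2 lam : 'I_n -> R, principal_curvatures f u nu lam &
    H = ('C(n, r)%:R)^-1 *
        \sum_(I : {set 'I_n} | #|I| == r) \prod_(i in I) lam i.

(* Main.v *)
Require Import Defs.
From HB Require Import structures.
From mathcomp Require Import all_boot all_order all_algebra.
From mathcomp Require Import all_classical all_reals all_analysis.
From mathcomp Require Import ring lra.

Set Implicit Arguments.
Unset Strict Implicit.
Unset Printing Implicit Defensive.

Import Order.TTheory GRing.Theory Num.Theory.
Import numFieldNormedType.Exports.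

Local Open Scope classical_set_scope.
Local Open Scope ring_scope.

(** Why the theorem holds.

    Fix a chart of N_* and a point u of it. Let x be the map x_g read in this
    chart, phi the coordinates in M of the base point, and f the immersion g
    read in these coordinates. Put X = 'J x u, P = 'J phi u, G = 'J f (phi u),
    and let A be the matrix of the products <x, d_l d_k f>, which is the second
    fundamental form of g in the normal direction x ([normal_hessian]).

    Since x is orthogonal to f o phi and to the partial derivatives of f, the
    vector f (phi u) is orthogonal to x and to the rows of X: the position
    vector of g is, up to sign, the unit normal of the hypersurface.
    Differentiating the orthogonality of x and the partial derivatives of f
    gives the Weingarten equation X G^T = - P A ([gauss_weingarten]).

    The matrix A is symmetric ([normal_hessian_sym], a case of Schwarz's theorem
    [derive_symmetric]), traceless with respect to the first fundamental form
    G G^T because g is minimal, and nonzero precisely because the point lies in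
    N_* ([star_hessian]). A nonzero symmetric traceless form on a plane has
    negative determinant ([traceless_sym_gram]). So A is invertible, and by the
    Weingarten equation a vector in the kernel of X is also in that of P, hence
    zero: x_g is an immersion ([gauss_free]).

    Then the rows of G, being orthogonal to x and to f, are combinations G = L X
    of the rows of X, and the shape operator is P L up to sign. The 4 x 4 matrix
    P L has the same nonzero spectrum as the 2 x 2 matrix L P = - G G^T A^-1
    ([char_poly_mulmxC]), which is traceless with negative determinant. The
    principal curvatures are therefore 0, 0, a, -a, and H_1 = H_3 = H_4 = 0
    ([char_poly_gauss_shape], [r_mean_curvature1], [r_mean_curvature_ge3]).

    N_* is open in N since A depends continuously on the unit normal vector
    ([star_open]). It is a manifold because around (p0, V0) a unit normal vector
    V with <V, V0> > 0 is determined by the products of V / <V, V0> with two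
    fixed vectors; the inverse chart solves a linear system and normalises the solution
    ([bundle_chart], [star_embedded]). Its smoothness rests on the stability of
    C^k maps under sums, products, inverses, inverse square roots and
    composition. *)

(** * Maps of class C^k *)

Section Calculus.
Variable R : realType.
Implicit Types V W : normedModType R.

Lemma near_eq_differentiable V W (f g : V -> W) (x : V) :
  {near x, f =1 g} -> differentiable f x -> differentiable g x.
Proof.
move=> fg df; have fgx : f x = g x := nbhs_singleton fg.
have [dfc dfE] := (diff_locallyP x f).1 df.
have gE : g \o shift x = cst (g x) + 'd f x +o_ 0 id.
  apply/eqaddoP => e e0; have := (eqaddoP _ _ _ _).1 dfE e e0.
  apply: filter_app; have := (near_shift 0 x (fun y => f y = g y)).
  move=> E; have : \forall y \near 0, f (y + x) = g (y + x).
    by have := fg; rewrite (near_shift 0 x) subr0 => h; exact: h.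
  apply: filter_app; near=> y => fgy.
  by rewrite /= -fgx !fctE /= fgy.
apply/diff_locallyP; rewrite (diff_unique dfc gE); split => //.
Unshelve. all: by end_near. Qed.

Lemma Ck_on_sub V W k (U U' : set V) (f : V -> W) :
  U' `<=` U -> Ck_on k U f -> Ck_on k U' f.
Proof.
elim: k f => [|k IH] f sUU' /=; first by move=> fc x /sUU'/fc.
by move=> [fd fD]; split=> [x /sUU'/fd //|v]; exact: IH.
Qed.

(** The definition of [Ck_on] only tests the points of U, one at a time; so a
    different neighbourhood, such as a different chart of M, may serve at each
    of them. *)
Lemma Ck_on_pt V W k (U : set V) (f : V -> W) :
  (forall x, U x -> Ck_on k [set x] f) -> Ck_on k U f.
Proof.
elim: k f => [|k IH] f /= fU; first by move=> x /fU; exact.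
split=> [x Ux|v]; first by have [+ _] := fU x Ux; apply.
by apply: IH => x Ux; have [_ +] := fU x Ux; apply.
Qed.

(** On an open set the values determine the derivatives, which is what every
    closure property below relies on to rewrite a derivative in closed form. *)
Lemma Ck_on_eq V W k (U : set V) (f g : V -> W) : open U ->
  (forall x, U x -> f x = g x) -> Ck_on k U f -> Ck_on k U g.
Proof.
move=> oU; elim: k f g => [|k IH] f g fg /=.
  move=> fc x Ux; rewrite /prop_for /continuous_at -fg //.
  apply: cvg_trans (fc x Ux); apply: near_eq_cvg.
  by near do apply: fg; exact: open_nbhs_nbhs.
have nfg x : U x -> \near x, f x = g x.
  by move=> Ux; near do apply: fg; exact: open_nbhs_nbhs.
move=> [fd fD]; split=> [x Ux|v].
  by apply: near_eq_differentiable (fd x Ux); exact: nfg.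
by apply: IH (fD v) => x Ux; apply: near_eq_derive; exact: nfg.
Unshelve. all: by end_near. Qed.

Lemma Ck_onS V W k (U : set V) (f : V -> W) : Ck_on k.+1 U f -> Ck_on k U f.
Proof.
elim: k f => [|k IH] f; first by move=> [fd _] x /fd/differentiable_continuous.
by move=> [fd fD]; split=> // v; exact: IH.
Qed.

Lemma Ck_on_cst V W k (U : set V) (w : W) : Ck_on k U (fun _ : V => w).
Proof.
elim: k w => [|k IH] w /=; first by move=> x _; apply: cst_continuous.
split=> [x _|v]; first exact: differentiable_cst.
rewrite (_ : (fun x => 'D_v _ x) = fun=> 0); first exact: IH.
by apply/funext => x; exact: (derive_cst w x v).
Qed.

Lemma Ck_onD V W k (U : set V) (f g : V -> W) : open U ->
  Ck_on k U f -> Ck_on k U g -> Ck_on k U (fun x => f x + g x).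
Proof.
move=> oU; elim: k f g => [|k IH] f g /=.
  by move=> fc gc x Ux; apply: cvgD; [exact: fc|exact: gc].
move=> [fd fD] [gd gD]; split=> [x Ux|v].
  by apply: differentiableD; [exact: fd|exact: gd].
apply: (Ck_on_eq oU _ (IH _ _ (fD v) (gD v))) => x Ux.
by rewrite deriveD//; apply: diff_derivable; [exact: fd|exact: gd].
Qed.

Lemma Ck_onM V k (U : set V) (f g : V -> R) : open U ->
  Ck_on k U f -> Ck_on k U g -> Ck_on k U (fun x => f x * g x).
Proof.
move=> oU; elim: k f g => [|k IH] f g.
  by move=> fc gc x Ux; apply: cvgM; [exact: fc|exact: gc].
move=> fC gC; have [fd fD] := fC; have [gd gD] := gC.
split=> [x Ux|v].
  by apply: differentiableM; [exact: fd|exact: gd].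
have := Ck_onD oU (IH _ _ (Ck_onS fC) (gD v)) (IH _ _ (Ck_onS gC) (fD v)).
apply: Ck_on_eq => // x Ux.
by rewrite deriveM//; apply: diff_derivable; [exact: fd|exact: gd].
Qed.

(** By induction: the derivative - f' / f^2 is a product of f' and of copies of
    1 / f, for which the previous order of smoothness suffices. *)
Lemma Ck_onV V k (U : set V) (f : V -> R) : open U ->
  (forall x, U x -> f x != 0) -> Ck_on k U f -> Ck_on k U (fun x => (f x)^-1).
Proof.
move=> oU f0; elim: k => [|k IH].
  by move=> fc x Ux; apply: cvgV; [exact: f0|exact: fc].
move=> fC; have [fd fD] := fC; have fV := IH (Ck_onS fC).
split=> [x Ux|v]; first by apply: differentiableV; [exact: fd|exact: f0].
have := Ck_onM oU (@Ck_on_cst V R k U (-1))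
  (Ck_onM oU (Ck_onM oU fV fV) (fD v)).
apply: Ck_on_eq => // x Ux; rewrite deriveV; [|exact: f0|exact/diff_derivable/fd].
by rewrite mulN1r scaleNr expr2 invfM.
Qed.

Lemma derive_linear_comp V W W' (L : {linear W -> W'}) (f : V -> W) x v :
  continuous L -> differentiable f x -> 'D_v (L \o f) x = L ('D_v f x).
Proof.
move=> cL df; have dL y : differentiable L y by exact: linear_differentiable.
rewrite !deriveE//; last exact: differentiable_comp.
by rewrite diff_comp// diff_lin.
Qed.

Lemma Ck_on_linear_comp V W W' k (U : set V) (L : {linear W -> W'})
    (f : V -> W) : open U -> continuous L ->
  Ck_on k U f -> Ck_on k U (L \o f).
Proof.
move=> oU cL; elim: k f => [|k IH] f /=.
  by move=> fc x Ux; apply: continuous_comp; [exact: fc|exact: cL].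
move=> [fd fD]; split=> [x Ux|v].
  apply: differentiable_comp; [exact: fd|exact: linear_differentiable].
apply: (Ck_on_eq oU _ (IH _ (fD v))) => x Ux /=.
by rewrite derive_linear_comp//; exact: fd.
Qed.

(** The inverse square root is handled as a whole because its derivative
    - f' f^(-3/2) / 2 involves only f' and f^(-1/2), so that the induction of
    [Ck_onV] applies; the square root alone would not close up. *)
Lemma Ck_on_rsqrt V k (U : set V) (f : V -> R) : open U ->
  (forall x, U x -> 0 < f x) -> Ck_on k U f ->
  Ck_on k U (fun x => (Num.sqrt (f x))^-1).
Proof.
move=> oU f0; have s0 x : U x -> Num.sqrt (f x) != 0.
  by move=> /f0 fx; rewrite gt_eqF// sqrtr_gt0.
have ds x : U x -> differentiable (@Num.sqrt R) (f x).
  move=> /f0 fx; apply/derivable1_diffP.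
  exact: (@ex_derive _ _ _ _ _ _ _ (is_derive1_sqrt fx)).
elim: k => [|k IH].
  move=> fc x Ux; apply: cvgV; first exact: s0.
  by apply: continuous_comp; [exact: fc|exact: sqrt_continuous].
move=> fC; have [fd fD] := fC; have fV := IH (Ck_onS fC).
have dsf x : U x -> differentiable (fun x => Num.sqrt (f x)) x.
  by move=> Ux; apply: differentiable_comp; [exact: fd|exact: ds].
split=> [x Ux|v]; first by apply: differentiableV; [exact: dsf|exact: s0].
have := Ck_onM oU (@Ck_on_cst V R k U (- 2^-1))
  (Ck_onM oU (Ck_onM oU fV (Ck_onM oU fV fV)) (fD v)).
apply: Ck_on_eq => // x Ux.
rewrite deriveV; [|exact: s0|exact/diff_derivable/dsf].
rewrite (deriveE v (dsf x Ux)).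
rewrite (diff_comp (fd x Ux) (ds x Ux)) /= -(deriveE v (fd x Ux)).
rewrite diff1E; last exact: ds.
rewrite derive1E derive_sqrt ?f0// /GRing.scale /= expr2 !invfM.
by ring.
Qed.

End Calculus.

(** * Smooth matrix-valued maps and Jacobian matrices *)

Section MatrixCalculus.
Variable R : realType.
Implicit Types V W : normedModType R.

Lemma smooth_on_sub V W (U U' : set V) (f : V -> W) :
  U' `<=` U -> smooth_on U f -> smooth_on U' f.
Proof. by move=> UU' fs k; exact: Ck_on_sub (fs k). Qed.

Lemma smooth_on_pt V W (U : set V) (f : V -> W) :
  (forall x, U x -> smooth_on [set x] f) -> smooth_on U f.
Proof. by move=> fs k; apply: Ck_on_pt => x /fs; exact. Qed.

Lemma smooth_on_eq V W (U : set V) (f g : V -> W) : open U ->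
  (forall x, U x -> f x = g x) -> smooth_on U f -> smooth_on U g.
Proof. by move=> oU fg fs k; exact: Ck_on_eq (fs k). Qed.

Lemma smooth_on_differentiable V W (U : set V) (f : V -> W) x :
  smooth_on U f -> U x -> differentiable f x.
Proof. by move=> /(_ 1)[fd _]; exact: fd. Qed.

Lemma smooth_on_continuous V W (U : set V) (f : V -> W) x :
  smooth_on U f -> U x -> {for x, continuous f}.
Proof. by move=> /(_ 0) fc Ux; exact: fc. Qed.

Lemma smooth_on_derive V W (U : set V) (f : V -> W) v :
  smooth_on U f -> smooth_on U (fun x => 'D_v f x).
Proof. by move=> fs k; have [_] := fs k.+1; apply. Qed.

Lemma smooth_on_cst V W (U : set V) (w : W) : smooth_on U (fun _ : V => w).
Proof. by move=> k; exact: Ck_on_cst. Qed.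

Lemma smooth_on_linear_comp V W W' (U : set V) (L : {linear W -> W'})
    (f : V -> W) : open U -> continuous L ->
  smooth_on U f -> smooth_on U (L \o f).
Proof. by move=> oU cL fs k; exact: Ck_on_linear_comp. Qed.

(** The first derivatives of L are constant. *)
Lemma smooth_on_linear V W (U : set V) (L : {linear V -> W}) :
  continuous L -> smooth_on U L.
Proof.
move=> cL k; apply: (@Ck_on_sub _ _ _ _ setT) => //.
elim: k => [x _|k IH]; first exact: cL.
split=> [x _|v]; first exact: linear_differentiable.
apply: (@Ck_on_eq _ _ _ _ _ (fun=> L v)) (@Ck_on_cst _ _ _ _ _ _) => //.
  exact: openT.
by move=> x _; rewrite deriveE ?diff_lin//; exact: linear_differentiable.
Qed.

Section Open.
Variables (V : normedModType R) (U : set V).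
Hypothesis oU : open U.

Lemma smooth_onM (f g : V -> R) :
  smooth_on U f -> smooth_on U g -> smooth_on U (fun x => f x * g x).
Proof. by move=> fs gs k; exact: Ck_onM. Qed.

Lemma smooth_onV (f : V -> R) : (forall x, U x -> f x != 0) ->
  smooth_on U f -> smooth_on U (fun x => (f x)^-1).
Proof. by move=> f0 fs k; exact: Ck_onV. Qed.

Lemma smooth_on_rsqrt (f : V -> R) : (forall x, U x -> 0 < f x) ->
  smooth_on U f -> smooth_on U (fun x => (Num.sqrt (f x))^-1).
Proof. by move=> f0 fs k; exact: Ck_on_rsqrt. Qed.

Lemma Ck_on_sum W k I (r : seq I) (P : pred I) (F : I -> V -> W) :
  (forall i, P i -> Ck_on k U (F i)) ->
  Ck_on k U (fun x => \sum_(i <- r | P i) F i x).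
Proof.
move=> Fs; elim: r => [|i r IH].
  by apply: Ck_on_eq (@Ck_on_cst _ V W k U 0) => // x _; rewrite big_nil.
have [Pi|nPi] := boolP (P i).
  by apply: Ck_on_eq (Ck_onD oU (Fs _ Pi) IH) => // x _; rewrite big_cons Pi.
by apply: Ck_on_eq IH => // x _; rewrite big_cons (negbTE nPi).
Qed.

Lemma smooth_on_sum W I (r : seq I) (P : pred I) (F : I -> V -> W) :
  (forall i, P i -> smooth_on U (F i)) ->
  smooth_on U (fun x => \sum_(i <- r | P i) F i x).
Proof. by move=> Fs k; apply: Ck_on_sum => i /Fs. Qed.

Lemma smooth_on_prod I (r : seq I) (P : pred I) (F : I -> V -> R) :
  (forall i, P i -> smooth_on U (F i)) ->
  smooth_on U (fun x => \prod_(i <- r | P i) F i x).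
Proof.
move=> Fs; elim: r => [|i r IH].
  apply: smooth_on_eq (@smooth_on_cst V R U 1) => // x _; by rewrite big_nil.
have [Pi|nPi] := boolP (P i).
  apply: smooth_on_eq (smooth_onM (Fs _ Pi) IH) => // x _.
  by rewrite big_cons Pi.
by apply: smooth_on_eq IH => // x _; rewrite big_cons (negbTE nPi).
Qed.

Lemma Ck_on_entry k m n (f : V -> 'M[R]_(m, n)) i j :
  Ck_on k U f -> Ck_on k U (fun x => f x i j).
Proof.
have @L : {linear 'M[R]_(m, n) -> R}.
  by exists (fun N : 'M[R]_(_, _) => N i j); do 2![eexists]; do ?[constructor];
     rewrite ?mxE// => ? *; rewrite ?mxE//; move=> ?; rewrite !mxE.
have cL : continuous L by exact: coord_continuous.
exact: (Ck_on_linear_comp oU cL).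
Qed.

Lemma smooth_on_entry m n (f : V -> 'M[R]_(m, n)) i j :
  smooth_on U f -> smooth_on U (fun x => f x i j).
Proof. by move=> fs k; exact: Ck_on_entry. Qed.

Lemma smooth_on_scalel W (f : V -> R) (w : W) :
  smooth_on U f -> smooth_on U (fun x => f x *: w).
Proof.
have sw_lin : linear ( *:%R ^~ w : R -> _).
  by move=> u y z; rewrite scalerDl scalerA.
pose swM := GRing.isLinear.Build _ _ _ _ _ sw_lin.
pose L : {linear _ -> _} := HB.pack ( *:%R ^~ w) swM.
have cL : continuous L by exact: scalel_continuous.
exact: (smooth_on_linear_comp oU cL).
Qed.

Lemma smooth_on_mx m n (f : V -> 'M[R]_(m, n)) :
  (forall i j, smooth_on U (fun x => f x i j)) -> smooth_on U f.
Proof.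
move=> fs; have := @smooth_on_sum _ _ (index_enum 'I_m) xpredT
  (fun i x => \sum_j f x i j *: delta_mx i j).
have H i : true -> smooth_on U (fun x => \sum_j f x i j *: delta_mx i j).
  move=> _; apply: smooth_on_sum => j _; exact: smooth_on_scalel.
move=> /(_ H); apply: smooth_on_eq => // x _.
by rewrite [RHS]matrix_sum_delta.
Qed.

Lemma smooth_on_mulmx m n p (f : V -> 'M[R]_(m, n)) (g : V -> 'M[R]_(n, p)) :
  smooth_on U f -> smooth_on U g -> smooth_on U (fun x => f x *m g x).
Proof.
move=> fs gs; apply: smooth_on_mx => i j.
have H k : true -> smooth_on U (fun x => f x i k * g x k j).
  by move=> _; apply: smooth_onM; exact: smooth_on_entry.
apply: smooth_on_eq (@smooth_on_sum _ _ (index_enum _) _ _ H) => // x _.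
by rewrite mxE.
Qed.

Lemma smooth_on_scale m n (a : V -> R) (f : V -> 'M[R]_(m, n)) :
  smooth_on U a -> smooth_on U f -> smooth_on U (fun x => a x *: f x).
Proof.
move=> sa fs; apply: smooth_on_mx => i j.
have := smooth_onM sa (smooth_on_entry i j fs).
by apply: smooth_on_eq => // x _; rewrite mxE.
Qed.

Lemma smooth_on_trmx m n (f : V -> 'M[R]_(m, n)) :
  smooth_on U f -> smooth_on U (fun x => (f x)^T).
Proof.
move=> fs; apply: smooth_on_mx => i j.
apply: smooth_on_eq (smooth_on_entry j i fs) => // x _; by rewrite mxE.
Qed.

Lemma smooth_on_row_mx m n1 n2 (f : V -> 'M[R]_(m, n1))
    (g : V -> 'M[R]_(m, n2)) :
  smooth_on U f -> smooth_on U g -> smooth_on U (fun x => row_mx (f x) (g x)).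
Proof.
move=> fs gs; apply: smooth_on_mx => i j; case: (split_ordP j) => k ->.
  by apply: smooth_on_eq (smooth_on_entry i k fs) => // x _; rewrite row_mxEl.
by apply: smooth_on_eq (smooth_on_entry i k gs) => // x _; rewrite row_mxEr.
Qed.

Lemma smooth_on_col_mx m1 m2 n (f : V -> 'M[R]_(m1, n))
    (g : V -> 'M[R]_(m2, n)) :
  smooth_on U f -> smooth_on U g -> smooth_on U (fun x => col_mx (f x) (g x)).
Proof.
move=> fs gs; apply: smooth_on_mx => i j; case: (split_ordP i) => k ->.
  by apply: smooth_on_eq (smooth_on_entry k j fs) => // x _; rewrite col_mxEu.
by apply: smooth_on_eq (smooth_on_entry k j gs) => // x _; rewrite col_mxEd.
Qed.

Lemma smooth_on_det n (f : V -> 'M[R]_n) :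
  smooth_on U f -> smooth_on U (fun x => \det (f x)).
Proof.
move=> fs; apply: smooth_on_sum => s _.
apply: smooth_onM; first exact: smooth_on_cst.
by apply: smooth_on_prod => i _; exact: smooth_on_entry.
Qed.

(** Cramer's rule: the inverse is the adjugate, polynomial in the entries,
    divided by the determinant. *)
Lemma smooth_on_invmx n (f : V -> 'M[R]_n) :
  (forall x, U x -> f x \in unitmx) ->
  smooth_on U f -> smooth_on U (fun x => invmx (f x)).
Proof.
move=> f1 fs.
have adj : smooth_on U (fun x => \adj (f x)).
  apply: smooth_on_mx => i j.
  have : smooth_on U (fun x => cofactor (f x) j i).
    apply: smooth_onM; first exact: smooth_on_cst.
    apply: smooth_on_det; apply: smooth_on_mx => k l.
    apply: smooth_on_eq (smooth_on_entry (lift j k) (lift i l) fs) => // x _.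
    by rewrite !mxE.
  by apply: smooth_on_eq => // x _; rewrite mxE.
have dV : smooth_on U (fun x => (\det (f x))^-1).
  apply: smooth_onV (smooth_on_det fs) => x /f1.
  by rewrite unitmxE unitfE.
by apply: smooth_on_eq (smooth_on_scale dV adj) => // x /f1 fx; rewrite /invmx fx.
Qed.

End Open.

(** The chain rule expresses a derivative of f o phi through products of
    derivatives of phi with partial derivatives of f composed with phi, all of
    one order less; products of scalars are enough since f is scalar. *)
Lemma Ck_on_comp V k n (U : set V) (U' : set 'rV[R]_n) (f : 'rV[R]_n -> R)
    (phi : V -> 'rV[R]_n) : open U -> (forall x, U x -> U' (phi x)) ->
  Ck_on k U phi -> Ck_on k U' f -> Ck_on k U (f \o phi).
Proof.
move=> oU UU'; elim: k f => [|k IH] f.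
  move=> phic fc x Ux; apply: continuous_comp; first exact: phic.
  exact/fc/UU'.
move=> phiC fC; have [phid phiD] := phiC; have [fd fD] := fC.
split=> [x Ux|v].
  by apply: differentiable_comp; [exact: phid|exact/fd/UU'].
have H j : true -> Ck_on k U
    (fun x => 'D_v phi x 0 j * 'D_(delta_mx 0 j) f (phi x)).
  move=> _; apply: Ck_onM => //; first exact: (Ck_on_entry oU 0 j (phiD v)).
  exact: IH (Ck_onS phiC) (fD _).
apply: Ck_on_eq (Ck_on_sum oU (index_enum _) H) => // x Ux.
have dphi := phid x Ux; have df := fd _ (UU' x Ux).
rewrite (deriveE v (differentiable_comp dphi df)) (diff_comp dphi df) /=.
rewrite -(deriveE v dphi) [in RHS](row_sum_delta ('D_v phi x)) linear_sum.
by apply: eq_bigr => j _; rewrite linearZ /= -deriveE.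
Qed.

Lemma smooth_on_comp V m n p (U : set V) (U' : set 'rV[R]_p)
    (f : 'rV[R]_p -> 'M[R]_(m, n)) (phi : V -> 'rV[R]_p) :
  open U -> open U' -> (forall x, U x -> U' (phi x)) ->
  smooth_on U phi -> smooth_on U' f -> smooth_on U (f \o phi).
Proof.
move=> oU oU' UU' phis fs; apply: smooth_on_mx => // i j k.
apply: (@Ck_on_comp V k p U U' (fun y => f y i j) phi oU UU' (phis k)).
exact: Ck_on_entry.
Qed.

Lemma jacobianE m n (f : 'rV[R]_m -> 'rV[R]_n) u i :
  differentiable f u -> row i ('J f u) = 'D_(delta_mx 0 i) f u.
Proof. by move=> df; rewrite rowE deriveEjacobian. Qed.

Lemma smooth_on_jacobian m n (U : set 'rV[R]_m) (f : 'rV[R]_m -> 'rV[R]_n) :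
  open U -> smooth_on U f -> smooth_on U (fun u => 'J f u).
Proof.
move=> oU fs; apply: smooth_on_mx => // i j.
have := smooth_on_entry oU 0 j (smooth_on_derive (delta_mx 0 i) fs).
apply: smooth_on_eq => // u Uu.
by rewrite -jacobianE ?mxE//; exact: smooth_on_differentiable fs Uu.
Qed.

Lemma jacobian_comp k m n (f : 'rV[R]_k -> 'rV[R]_m) (g : 'rV[R]_m -> 'rV[R]_n)
    u : differentiable f u -> differentiable g (f u) ->
  'J (g \o f) u = 'J f u *m 'J g (f u).
Proof.
move=> df dg; apply/row_matrixP => i; rewrite !rowE mulmxA.
rewrite -(deriveEjacobian _ df) -(deriveEjacobian _ dg).
rewrite -deriveEjacobian; last exact: differentiable_comp.
by rewrite !deriveE//; [rewrite diff_comp|exact: differentiable_comp].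
Qed.

Lemma near_eq_jacobian m n (f g : 'rV[R]_m -> 'rV[R]_n) u :
  {near u, f =1 g} -> differentiable f u -> 'J f u = 'J g u.
Proof.
move=> fg df; apply/row_matrixP => i.
have dg := near_eq_differentiable fg df.
transitivity ('D_(delta_mx 0 i) f u); first exact: jacobianE.
transitivity ('D_(delta_mx 0 i) g u); last by symmetry; exact: jacobianE.
exact: (@near_eq_derive _ _ _ f g u (delta_mx 0 i) fg).
Qed.

Lemma smooth_on_lsubmx n1 n2 (U : set 'rV[R]_(n1 + n2)) :
  smooth_on U (lsubmx : 'rV[R]_(n1 + n2) -> 'rV[R]_n1).
Proof.
exact: (smooth_on_linear U (L := lsubmx) (@continuous_lsubmx _ _ _ _)).
Qed.

Lemma smooth_on_rsubmx n1 n2 (U : set 'rV[R]_(n1 + n2)) :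
  smooth_on U (rsubmx : 'rV[R]_(n1 + n2) -> 'rV[R]_n2).
Proof.
exact: (smooth_on_linear U (L := rsubmx) (@continuous_rsubmx _ _ _ _)).
Qed.

Lemma jacobian_id n (u : 'rV[R]_n) : 'J id u = 1%:M.
Proof.
have did : differentiable (id : 'rV[R]_n -> 'rV[R]_n) u by exact: ex_diff.
by apply/row_matrixP => i; rewrite jacobianE// derive_id row1.
Qed.

(** The chain rule gives the Jacobian matrix of Y a right inverse. *)
Lemma jacobian_left_inverse k m (Y : 'rV[R]_k -> 'rV[R]_m)
    (Psi : 'rV[R]_m -> 'rV[R]_k) t :
  differentiable Y t -> differentiable Psi (Y t) ->
  (\forall s \near t, Psi (Y s) = s) -> row_free ('J Y t).
Proof.
move=> dY dP PY; apply/row_freeP; exists ('J Psi (Y t)).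
rewrite -jacobian_comp// -(jacobian_id t).
exact: near_eq_jacobian (differentiable_comp dY dP).
Qed.

End MatrixCalculus.

Section JacobianSplit.
Variables (R : realType) (k n1 n2 : nat) (Y : 'rV[R]_k -> 'rV[R]_(n1 + n2)).
Variable u : 'rV[R]_k.
Hypothesis dY : differentiable Y u.

Lemma jacobian_lsubmx : 'J (lsubmx \o Y) u = lsubmx ('J Y u).
Proof.
apply/row_matrixP => i.
rewrite (_ : row i (lsubmx _) = lsubmx (row i ('J Y u))); last first.
  by apply/rowP => j; rewrite !mxE.
rewrite jacobianE; last first.
  exact: differentiable_comp dY (differentiable_lsubmx _).
rewrite jacobianE//.
exact: (derive_linear_comp (L := lsubmx) (delta_mx 0 i)
  (@continuous_lsubmx _ _ _ _) dY).
Qed.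

Lemma jacobian_rsubmx : 'J (rsubmx \o Y) u = rsubmx ('J Y u).
Proof.
apply/row_matrixP => i.
rewrite (_ : row i (rsubmx _) = rsubmx (row i ('J Y u))); last first.
  by apply/rowP => j; rewrite !mxE.
rewrite jacobianE; last first.
  exact: differentiable_comp dY (differentiable_rsubmx _).
rewrite jacobianE//.
exact: (derive_linear_comp (L := rsubmx) (delta_mx 0 i)
  (@continuous_rsubmx _ _ _ _) dY).
Qed.

End JacobianSplit.

(** * Symmetry of second derivatives *)

Section SecondDerivatives.
Variable R : realType.
Implicit Types V W : normedModType R.

(** Divided by h^2, with steps h v and h w, it tends to the second derivative
    along v and w in either order; being symmetric in the two steps, it forces
    the two orders to agree. *)
Definition second_difference V (f : V -> R) (x v w : V) : R :=
  f (v + w + x) - f (v + x) - (f (w + x) - f x).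

Lemma second_differenceC V (f : V -> R) x v w :
  second_difference f x v w = second_difference f x w v.
Proof. by rewrite /second_difference (addrC v w); ring. Qed.

Lemma is_derive_line V (f : V -> R) (v y : V) (s : R) :
  differentiable f (s *: v + y) ->
  is_derive s 1 (fun t : R => f (t *: v + y)) ('D_v f (s *: v + y)).
Proof.
move=> /diff_derivable-/(_ v) df.
have E : (fun h : R => h^-1 *: (((fun t : R => f (t *: v + y)) \o shift s) h%:A
        - f (s *: v + y))) =
    (fun h => h^-1 *: ((f \o shift (s *: v + y)) (h *: v) - f (s *: v + y))).
  by apply/funext => h /=; rewrite [_%:A]mulr1 scalerDl addrA.
split; first by rewrite /derivable E.
by rewrite /derive E.
Qed.

(** Schwarz's argument. The mean value theorem along v turns the second
    difference into h times the difference of two values of D_v f, at points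
    that differ by h w; the expansion of D_v f to first order at x evaluates
    the latter up to e times the distances from these points to x. *)
Lemma second_difference_approx V (U : set V) (f : V -> R) x v w (e : R) :
  open U -> U x -> (forall y, U y -> differentiable f y) ->
  differentiable (fun y => 'D_v f y) x -> 0 < e ->
  \forall h \near 0^'+,
    `|second_difference f x (h *: v) (h *: w) -
      h ^+ 2 * 'D_w (fun y => 'D_v f y) x|
    <= e * (`|v| + `|v| + `|w|) * h ^+ 2.
Proof.
move=> oU Ux fd dF e0; set F := fun y => 'D_v f y.
have [d d0 Hd] : exists2 d : R, 0 < d & forall y : V, `|y| < d ->
    U (y + x) /\ `|F (y + x) - (F x + 'd F x y)| <= e * `|y|.
  have nU : \forall y \near (0 : V), U (y + x).
    have := open_nbhs_nbhs (conj oU Ux).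
    by rewrite -[nbhs x _]/(\near x, U x) (near_shift 0 x) subr0; exact.
  have nF : \forall y \near (0 : V), `|F (y + x) - (F x + 'd F x y)| <= e * `|y|.
    exact: ((eqaddoP _ _ _ _).1 (diff_locally dF) e e0).
  have : nbhs (0 : V) [set y | U (y + x) /\
      `|F (y + x) - (F x + 'd F x y)| <= e * `|y|] by exact: filterI.
  move=> /nbhs_ballP[d /= d0 Hd].
  exists d => // y yd; apply: Hd.
  by rewrite -ball_normE /= sub0r normrN.
have sgt0 : 0 < `|v| + `|w| + 1 by rewrite ltr_wpDl// addr_ge0.
near=> h.
have h0 : 0 < h by near: h; exact: nbhs_right_gt.
have hd : h * (`|v| + `|w| + 1) < d.
  rewrite -ltr_pdivlMr//; near: h; apply: nbhs_right_lt.
  exact: divr_gt0.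
(* The flag c tells whether the step h w is added: the two points at which
   D_v f is expanded correspond to c = true and c = false. *)
have small s (c : bool) : 0 <= s -> s <= h ->
    `|s *: v + (h * c%:R) *: w| < d /\
    `|s *: v + (h * c%:R) *: w| <= h * (`|v| + c%:R * `|w|).
  move=> s0 sh; have b : `|s *: v + (h * c%:R) *: w| <= h * (`|v| + c%:R * `|w|).
    rewrite (le_trans (ler_normD _ _))// !normrZ mulrDr mulrA lerD//.
      by rewrite ler_wpM2r// ger0_norm.
    by rewrite normr_nat ger0_norm// ltW.
  split=> //; apply: le_lt_trans b (le_lt_trans _ hd).
  have cw : c%:R * `|w| <= `|w| by case: (c); rewrite /= ?mul1r ?mul0r.
  by rewrite ler_pM2l//; move: cw; lra.
pose g (c : bool) := fun s : R => f (s *: v + ((h * c%:R) *: w + x)).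
have dg c s : 0 <= s -> s <= h ->
    is_derive s 1 (g c) (F (s *: v + ((h * c%:R) *: w + x))).
  move=> s0 sh; apply: is_derive_line; rewrite addrA; apply: fd.
  by have [/Hd[]] := small s c s0 sh.
have dg2 s : 0 <= s -> s <= h -> is_derive s 1 (g true - g false)
    (F (s *: v + ((h * 1) *: w + x)) - F (s *: v + ((h * 0) *: w + x))).
  move=> s0 sh; have A1 := dg true s s0 sh; have A2 := dg false s s0 sh.
  exact: (is_deriveB A1 A2).
have [||s] := @MVT R (g true - g false) (fun s =>
  F (s *: v + ((h * 1) *: w + x)) - F (s *: v + ((h * 0) *: w + x))) 0 h h0.
- by move=> s; rewrite in_itv /= => /andP[s0 sh]; apply: dg2; exact: ltW.
- apply: derivable_within_continuous => s; rewrite in_itv /= => /andP[s0 sh].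
  by have := dg2 s s0 sh; move/(@ex_derive _ _ _ _ _ _ _).
rewrite in_itv /= => /andP[/ltW s0 /ltW sh].
rewrite subr0 /g !fctE !scale0r !add0r !mulr1 !mulr0 !scale0r !add0r => E.
have -> : second_difference f x (h *: v) (h *: w) =
  f (h *: v + (h *: w + x)) - f (h *: v + x) - (f (h *: w + x) - f x).
  by rewrite /second_difference addrA.
rewrite {}E (deriveE w dF).
have [b1 b1'] := small s true s0 sh; have [_ r1] := Hd _ b1.
have [b2 b2'] := small s false s0 sh; have [_ r2] := Hd _ b2.
move: r1 r2 b1' b2' {b1 b2}.
rewrite /= mulr1 mulr0 scale0r addr0 mul1r mul0r addr0 addrA.
have dE : 'd F x (s *: v + h *: w) = 'd F x (s *: v) + h * 'd F x w.
  by rewrite linearD; congr (_ + _); rewrite linearZ.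
rewrite dE => r1 r2 b1 b2.
set a := F _ in r1 *; set b := F _ in r2 *.
set p := 'd _ _ _ in r1 r2 *; set q := 'd _ _ w in r1 *.
have ub : `|a - b - h * q| <= e * (`|v| + `|v| + `|w|) * h.
  have -> : a - b - h * q = (a - (F x + (p + h * q))) - (b - (F x + p)) by ring.
  rewrite (le_trans (ler_normB _ _))// (le_trans (lerD r1 r2))//.
  rewrite -mulrDr -mulrA ler_pM2l//.
  by rewrite (le_trans (lerD b1 b2))// -mulrDr mulrC ler_pM2r// addrAC.
have -> : (a - b) * h - h ^+ 2 * q = (a - b - h * q) * h by ring.
by rewrite normrM (gtr0_norm h0) expr2 mulrA ler_pM2r.
Unshelve. all: by end_near. Qed.

(** Both iterated derivatives approximate the same second difference up to
    an arbitrary multiple of h^2. *)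
Lemma derive_symmetric V (U : set V) (f : V -> R) x v w :
  open U -> U x -> (forall y, U y -> differentiable f y) ->
  differentiable (fun y => 'D_v f y) x -> differentiable (fun y => 'D_w f y) x ->
  'D_w (fun y => 'D_v f y) x = 'D_v (fun y => 'D_w f y) x.
Proof.
move=> oU Ux fd dv dw; apply/eqP; rewrite -subr_eq0 -normr_le0.
apply/ler_addgt0Pr => e e0; rewrite add0r.
set A := 'D_w _ x; set B := 'D_v _ x.
pose C := (`|v| + `|v| + `|w|) + (`|w| + `|w| + `|v|) + 1.
have C0 : 0 < C by rewrite /C ltr_wpDl// !addr_ge0.
have e'0 : 0 < e / C by exact: divr_gt0.
near (0 : R)^'+ => h.
have h0 : 0 < h by near: h; exact: nbhs_right_gt.
have H1 : `|second_difference f x (h *: v) (h *: w) - h ^+ 2 * A|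
    <= e / C * (`|v| + `|v| + `|w|) * h ^+ 2.
  by near: h; exact: (second_difference_approx w oU Ux fd dv e'0).
have H2 : `|second_difference f x (h *: w) (h *: v) - h ^+ 2 * B|
    <= e / C * (`|w| + `|w| + `|v|) * h ^+ 2.
  by near: h; exact: (second_difference_approx v oU Ux fd dw e'0).
rewrite second_differenceC in H2.
have h20 : 0 < h ^+ 2 by exact: exprn_gt0.
rewrite -(ler_pM2r h20) -(gtr0_norm h20) -normrM.
set S := second_difference _ _ _ _ in H1 H2.
have -> : (A - B) * h ^+ 2 = (S - h ^+ 2 * B) - (S - h ^+ 2 * A) by ring.
rewrite (le_trans (ler_normB _ _))// (le_trans (lerD H2 H1))//.
rewrite -mulrDl -mulrDr (gtr0_norm h20) ler_pM2r// mulrAC -mulrA.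
by rewrite ler_piMr ?ltW// ltr_pdivrMr// mul1r /C addrC ltr_pwDr.
Unshelve. all: by end_near. Qed.

End SecondDerivatives.

(** * Inner products and second derivatives in a normal direction *)

Section Dot.
Variables (R : realType) (m : nat).
Implicit Types u v w : 'rV[R]_m.

Lemma dotE v w : dot v w = \sum_k v 0 k * w 0 k.
Proof. by rewrite /dot mxE; apply: eq_bigr => k _; rewrite mxE. Qed.

Lemma dotC v w : dot v w = dot w v.
Proof. by rewrite !dotE; apply: eq_bigr => k _; rewrite mulrC. Qed.

Lemma dotDl u v w : dot (u + v) w = dot u w + dot v w.
Proof. by rewrite /dot mulmxDl mxE. Qed.

Lemma dotZl a v w : dot (a *: v) w = a * dot v w.
Proof. by rewrite /dot -scalemxAl mxE. Qed.

Lemma dotDr u v w : dot u (v + w) = dot u v + dot u w.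
Proof. by rewrite dotC dotDl !(dotC u). Qed.

Lemma dotZr a v w : dot v (a *: w) = a * dot v w.
Proof. by rewrite dotC dotZl dotC. Qed.

Lemma dot0l w : dot 0 w = 0.
Proof. by rewrite /dot mul0mx mxE. Qed.

Lemma dot0r w : dot w 0 = 0.
Proof. by rewrite dotC dot0l. Qed.

Lemma dotNr v w : dot v (- w) = - dot v w.
Proof. by rewrite -scaleN1r dotZr mulN1r. Qed.

Lemma dotBr u v w : dot u (v - w) = dot u v - dot u w.
Proof. by rewrite dotDr dotNr. Qed.

Lemma dot_sumr I (r : seq I) (P : pred I) (F : I -> 'rV[R]_m) v :
  dot v (\sum_(i <- r | P i) F i) = \sum_(i <- r | P i) dot v (F i).
Proof.
elim/big_rec2: _ => [|i y1 y2 _ <-]; first by rewrite dot0r.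
by rewrite dotDr.
Qed.

Lemma dot_ge0 v : 0 <= dot v v.
Proof. by rewrite dotE sumr_ge0// => k _; rewrite -expr2 sqr_ge0. Qed.

Lemma dot_eq0 v : (dot v v == 0) = (v == 0).
Proof.
apply/eqP/eqP => [|->]; last by rewrite dot0l.
rewrite dotE => /eqP; rewrite psumr_eq0 => [/allP v0|k _]; last first.
  by rewrite -expr2 sqr_ge0.
apply/rowP => k; have := v0 k (mem_index_enum _).
by rewrite /= mulf_eq0 orbb mxE => /eqP.
Qed.

Lemma dot_mull k (A : 'M[R]_(k, m)) (v : 'rV_k) w :
  dot (v *m A) w = dot v (w *m A^T).
Proof. by rewrite /dot trmx_mul trmxK mulmxA. Qed.

Lemma dot_mulr k (A : 'M[R]_(k, m)) (v : 'rV_k) w :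
  dot w (v *m A) = dot (w *m A^T) v.
Proof. by rewrite /dot trmx_mul mulmxA. Qed.

Lemma mulmx_tr_dot k l (A : 'M[R]_(k, m)) (B : 'M[R]_(l, m)) i j :
  (A *m B^T) i j = dot (row i A) (row j B).
Proof. by rewrite dotE mxE; apply: eq_bigr => s _; rewrite !mxE. Qed.

End Dot.

Section DotCalculus.
Variable R : realType.

Lemma is_derive_entry (V : normedModType R) m n (f : V -> 'M[R]_(m, n)) x v i j :
  differentiable f x -> is_derive x v (fun y => f y i j) ('D_v f x i j).
Proof.
move=> /diff_derivable-/(_ v) df; split; first exact: (derivable_mxP f x v).1.
by rewrite derive_mx// mxE.
Qed.

Lemma derive_dot (V : normedModType R) m (F G : V -> 'rV[R]_m) x v :
  differentiable F x -> differentiable G x ->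
  'D_v (fun y => dot (F y) (G y)) x
    = dot ('D_v F x) (G x) + dot (F x) ('D_v G x).
Proof.
move=> dF dG; have FE k := is_derive_entry v 0 k dF.
have GE k := is_derive_entry v 0 k dG.
have E k := is_deriveM (FE k) (GE k).
rewrite (_ : (fun y => _) = \sum_(k < m) (fun y => F y 0 k * G y 0 k)).
  rewrite (@derive_val _ _ _ _ _ _ _ (is_derive_sum E)) !dotE addrC -big_split.
  apply: eq_bigr => k _ /=; congr (_ + _); exact: mulrC.
by apply/funext => y; rewrite dotE fct_sumE.
Qed.

(** The form in which orthogonality relations are differentiated. *)
Lemma derive_dot_cst (V : normedModType R) m (F G : V -> 'rV[R]_m) x v c :
  differentiable F x -> differentiable G x ->
  (\forall y \near x, dot (F y) (G y) = c) ->
  dot ('D_v F x) (G x) = - dot (F x) ('D_v G x).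
Proof.
move=> dF dG nc; apply/eqP; rewrite -addr_eq0 -derive_dot//.
by rewrite (near_eq_derive v (g := cst c)) // derive_cst.
Qed.

(** When V is normal to f, this is the second fundamental form of f in the
    direction V: the projection onto the normal space does not change the
    product with V (see [dot_normal_proj]). *)
Definition normal_hessian n m (f : 'rV[R]_n -> 'rV[R]_m) u (V : 'rV[R]_m) :
    'M[R]_n :=
  \matrix_(l, k) dot V ('D_(delta_mx 0 l) (fun x => 'D_(delta_mx 0 k) f x) u).

Variables (n m : nat) (U : set 'rV[R]_n) (f : 'rV[R]_n -> 'rV[R]_m).
Hypotheses (oU : open U) (fs : smooth_on U f).

Lemma dot_derive_partial u V xi k : U u ->
  dot V ('D_xi (fun x => 'D_(delta_mx 0 k) f x) u)
    = (xi *m normal_hessian f u V) 0 k.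
Proof.
move=> Uu; have dk := smooth_on_differentiable
  (smooth_on_derive (delta_mx 0 k) fs) Uu.
rewrite deriveEjacobian// mulmx_sum_row dot_sumr mxE; apply: eq_bigr => l _.
by rewrite dotZr mxE; congr (_ * dot _ _); exact: jacobianE.
Qed.

Lemma normal_hessian_sym u V : U u ->
  (normal_hessian f u V)^T = normal_hessian f u V.
Proof.
move=> Uu; apply/matrixP => l k; rewrite [LHS]mxE [LHS]mxE [RHS]mxE.
apply: (congr1 (dot V)).
apply/rowP => a.
have E i j : 'D_(delta_mx 0 i) (fun x => 'D_(delta_mx 0 j) f x) u 0 a
    = 'D_(delta_mx 0 i) (fun x => 'D_(delta_mx 0 j) (fun y => f y 0 a) x) u.
  have dj := smooth_on_differentiable (smooth_on_derive (delta_mx 0 j) fs) Uu.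
  rewrite -(@derive_val _ _ _ _ _ _ _ (is_derive_entry _ 0 a dj)).
  apply: near_eq_derive; near=> x; symmetry.
  have Ux : U x by near: x; exact: open_nbhs_nbhs.
  exact: (@derive_val _ _ _ _ _ _ _
    (is_derive_entry _ 0 a (smooth_on_differentiable fs Ux))).
apply: etrans (E k l) _; apply: etrans (esym (E l k)).
have fas := smooth_on_entry oU 0 a fs.
apply: (derive_symmetric oU Uu) => [y||].
- exact: smooth_on_differentiable.
- exact: smooth_on_differentiable (smooth_on_derive _ fas) Uu.
- exact: smooth_on_differentiable (smooth_on_derive _ fas) Uu.
Unshelve. all: by end_near. Qed.

(** The second fundamental form is a tensor: the second derivatives of phi
    enter the chain rule only through the differential of f, which is
    orthogonal to V. *)
Lemma derive2_comp_normal p (phi : 'rV[R]_p -> 'rV[R]_n) (U' : set 'rV[R]_p)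
    v V xi eta : open U' -> smooth_on U' phi -> U' v -> U (phi v) ->
  V *m ('J f (phi v))^T = 0 ->
  dot V ('D_xi (fun x => 'D_eta (f \o phi) x) v)
    = dot ((xi *m 'J phi v) *m normal_hessian f (phi v) V) (eta *m 'J phi v).
Proof.
move=> oU' phis U'v Upv V0.
have [W [oW Wv WU' WU]] : exists W : set 'rV[R]_p,
    [/\ open W, W v, W `<=` U' & forall x, W x -> U (phi x)].
  have : nbhs v (U' `&` phi @^-1` U).
    apply: filterI; first exact: open_nbhs_nbhs.
    exact: (smooth_on_continuous phis U'v) (open_nbhs_nbhs (conj oU Upv)).
  rewrite nbhsE => -[W [oW Wv] WS]; exists W; split=> // x /WS[] //.
have phiW := smooth_on_sub WU' phis.
have fphi : smooth_on W (f \o phi) := smooth_on_comp oW oU WU phiW fs.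
have Jphi := smooth_on_comp oW oU WU phiW (smooth_on_jacobian oU fs).
pose G (x : 'rV[R]_p) := V *m ('J f (phi x))^T.
have Gs : smooth_on W G.
  by apply: smooth_on_mulmx => //; [exact: smooth_on_cst|exact: smooth_on_trmx].
have Wd k (F : 'rV[R]_p -> 'rV[R]_k) : smooth_on W F -> differentiable F v.
  by move=> Fs; exact: smooth_on_differentiable Fs Wv.
have dEf := Wd _ _ (smooth_on_derive eta fphi).
have := derive_dot xi (Wd _ _ (smooth_on_cst W V)) dEf.
rewrite derive_cst dot0l add0r => <-.
(* G vanishes at v, so that in the product rule only its derivative is left. *)
rewrite (near_eq_derive _ (g := fun x => dot ('D_eta phi x) (G x))); last first.
  near=> x; have Wx : W x by near: x; exact: open_nbhs_nbhs.
  have dx := smooth_on_differentiable phiW Wx.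
  have fx := smooth_on_differentiable fs (WU _ Wx).
  rewrite (deriveEjacobian _ (differentiable_comp dx fx)) (jacobian_comp dx fx).
  by rewrite mulmxA -(deriveEjacobian _ dx) dot_mulr dotC.
rewrite derive_dot; [|exact: Wd _ _ (smooth_on_derive eta phiW)|exact: Wd _ _ Gs].
rewrite [G v]V0 dot0r add0r dotC -(deriveEjacobian _ (Wd _ _ phiW)).
congr dot; apply/rowP => k.
rewrite -(@derive_val _ _ _ _ _ _ _ (is_derive_entry xi 0 k (Wd _ _ Gs))).
pose Dk := fun x => 'D_(delta_mx 0 k) f x.
have Dks : smooth_on U Dk := smooth_on_derive _ fs.
have Dkp : smooth_on W (Dk \o phi) := smooth_on_comp oW oU WU phiW Dks.
rewrite (near_eq_derive _ (g := fun x => dot V (Dk (phi x)))); last first.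
  near=> x; have Wx : W x by near: x; exact: open_nbhs_nbhs.
  rewrite /Dk -jacobianE; last exact: smooth_on_differentiable fs (WU _ Wx).
  by rewrite mulmx_tr_dot row_id.
rewrite (derive_dot xi (Wd _ _ (smooth_on_cst W V)) (Wd _ _ Dkp)).
rewrite derive_cst dot0l add0r (deriveE _ (Wd _ _ Dkp)).
have dDk := smooth_on_differentiable Dks Upv.
rewrite (diff_comp (Wd _ _ phiW) dDk) /= -(deriveE _ (Wd _ _ phiW)).
rewrite -(deriveE _ dDk) dot_derive_partial//.
by rewrite (deriveEjacobian _ (Wd _ _ phiW)).
Unshelve. all: by end_near. Qed.

End DotCalculus.

Section SmoothHessian.
Variable R : realType.

Lemma smooth_on_dot (V : normedModType R) m (U : set V) (F G : V -> 'rV[R]_m) :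
  open U -> smooth_on U F -> smooth_on U G ->
  smooth_on U (fun t => dot (F t) (G t)).
Proof.
move=> oU Fs Gs; apply: (smooth_on_entry oU 0 0).
by apply: smooth_on_mulmx => //; exact: smooth_on_trmx.
Qed.

Lemma smooth_on_normal_hessian (V : normedModType R) n m (U : set V)
    (U' : set 'rV[R]_n) (f : 'rV[R]_n -> 'rV[R]_m) phi (W : V -> 'rV[R]_m) :
  open U -> open U' -> (forall t, U t -> U' (phi t)) -> smooth_on U' f ->
  smooth_on U phi -> smooth_on U W ->
  smooth_on U (fun t => normal_hessian f (phi t) (W t)).
Proof.
move=> oU oU' UU' fs phis Ws; apply: smooth_on_mx => // l k.
have := smooth_on_dot oU Ws (smooth_on_comp oU oU' UU' phis
  (smooth_on_derive (delta_mx 0 l) (smooth_on_derive (delta_mx 0 k) fs))).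
by apply: smooth_on_eq => // t _; rewrite mxE.
Qed.

End SmoothHessian.

(** * Matrices over the reals *)

Section LinearAlgebra.
Variable R : realType.

Lemma dot_row_free k m (X : 'M[R]_(k, m)) (z : 'rV_k) :
  row_free X -> dot (z *m X) (z *m X) = 0 -> z = 0.
Proof.
move=> fX /eqP; rewrite dot_eq0 => /eqP zX0.
by apply: (row_free_inj fX); rewrite zX0 mul0mx.
Qed.

Lemma gram_unitmx k m (X : 'M[R]_(k, m)) : row_free X -> X *m X^T \in unitmx.
Proof.
move=> fX; rewrite -row_free_unit; apply: inj_row_free => z zX0.
by apply: (dot_row_free fX); rewrite dot_mulr -mulmxA zX0 dot0l.
Qed.

(** A vector and its projection differ by an element of the row space of A,
    which is orthogonal to v. *)
Lemma dot_normal_proj k m (A : 'M[R]_(k, m)) (w v : 'rV[R]_m) :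
  v *m A^T = 0 -> dot v (w *m normal_proj A) = dot v w.
Proof.
move=> vA0; set K := kermx A^T.
have cap0 : (K :&: <<A>>)%MS = 0.
  apply/eqP/rowV0P => z; rewrite sub_capmx genmxE => /andP[/sub_kermxP zA].
  move=> /submxP[y zE]; apply/eqP; rewrite -dot_eq0 {2}zE.
  by rewrite dot_mulr zA dot0l.
have full : (K + <<A>> == (1%:M : 'M[R]_m))%MS.
  rewrite -(mxrank_leqif_eq (submx1 _)) mxrank1 mxrank_disjoint_sum//.
  by rewrite mxrank_ker mxrank_tr mxrank_gen subnK// rank_leq_col.
have : (w - w *m normal_proj A <= <<A>>)%MS.
  apply: proj_mx_compl_sub; apply: submx_trans (submx1 _) _.
  by have /andP[] := full.
rewrite genmxE => /submxP[y yE]; apply/eqP; rewrite eq_sym -subr_eq0 -dotBr yE.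
by rewrite dot_mulr vA0 dot0l.
Qed.

(** The nonzero spectra of P L and L P agree, with multiplicity: both sides are
    the determinant of the block matrix with rows ('X, P) and (L, 1) times 'X^n,
    its lower left corner being eliminated by column and by row operations. *)
Lemma char_poly_mulmxC m n (P : 'M[R]_(m, n)) (L : 'M[R]_(n, m)) :
  char_poly (P *m L) * 'X^n = 'X^m * char_poly (L *m P).
Proof.
pose p := map_mx polyC P; pose l := map_mx polyC L.
pose B := block_mx 'X%:M p l 1%:M.
have E1 : B *m block_mx 1%:M 0 (- l) 1%:M
    = block_mx (char_poly_mx (P *m L)) p 0 1%:M.
  rewrite mulmx_block !mulmx1 !mulmx0 mulmxN !mul1mx addrN !add0r /char_poly_mx.
  by rewrite map_mxM.
have E2 : block_mx 1%:M 0 (- l) 'X%:M *m B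
    = block_mx 'X%:M p 0 (char_poly_mx (L *m P)).
  rewrite mulmx_block !mul1mx !mul0mx mulNmx !addr0 mulmx1 /char_poly_mx.
  rewrite map_mxM mulNmx [_ + _%:M]addrC; congr block_mx.
  by rewrite mul_scalar_mx mul_mx_scalar addNr.
have := congr1 determinant E1; have := congr1 determinant E2.
rewrite !det_mulmx !det_lblock !det_ublock !det1 !det_scalar !mul1r !mulr1.
by rewrite /char_poly => <- <-; rewrite mulrC.
Qed.

Lemma det_mx22 (M : 'M[R]_2) : \det M = M 0 0 * M 1 1 - M 0 1 * M 1 0.
Proof.
rewrite (expand_det_row _ 0) !big_ord_recl big_ord0 addr0 /cofactor !det_mx11.
rewrite !mxE /= expr0 mul1r expr1 mulN1r mulrN.
by congr (_ * M _ _ - M _ _ * M _ _); apply/val_inj.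
Qed.

Lemma big_ord2 (V : nmodType) (F : 'I_2 -> V) : \sum_i F i = F 0 + F 1.
Proof.
rewrite !big_ord_recl big_ord0 addr0.
by congr (F _ + F _); apply/val_inj.
Qed.

Lemma invmx22 (M : 'M[R]_2) : M \in unitmx ->
  [/\ \det M * invmx M 0 0 = M 1 1, \det M * invmx M 0 1 = - M 0 1,
      \det M * invmx M 1 0 = - M 1 0 & \det M * invmx M 1 1 = M 0 0].
Proof.
move=> /mulmxV MV; have MVE i j : (M *m invmx M) i j = (i == j)%:R.
  by rewrite MV mxE.
have := MVE 0 0; have := MVE 0 1; have := MVE 1 0; have := MVE 1 1.
rewrite !mxE !big_ord2 /= det_mx22.
set p := invmx M => e11 e10 e01 e00; split.
- transitivity (M 1 1 * (M 0 0 * p 0 0 + M 0 1 * p 1 0)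
    - M 0 1 * (M 1 0 * p 0 0 + M 1 1 * p 1 0)); [ring|rewrite e00 e10; ring].
- transitivity (M 1 1 * (M 0 0 * p 0 1 + M 0 1 * p 1 1)
    - M 0 1 * (M 1 0 * p 0 1 + M 1 1 * p 1 1)); [ring|rewrite e01 e11; ring].
- transitivity (M 0 0 * (M 1 0 * p 0 0 + M 1 1 * p 1 0)
    - M 1 0 * (M 0 0 * p 0 0 + M 0 1 * p 1 0)); [ring|rewrite e00 e10; ring].
- transitivity (M 0 0 * (M 1 0 * p 0 1 + M 1 1 * p 1 1)
    - M 1 0 * (M 0 0 * p 0 1 + M 0 1 * p 1 1)); [ring|rewrite e01 e11; ring].
Qed.

Lemma char_poly_traceless22 (K : 'M[R]_2) : \tr K = 0 ->
  char_poly K = 'X^2 + (\det K)%:P.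
Proof.
move=> trK; apply/polyP => i; rewrite coefD coefXn coefC.
have [c2 c1 c0] : [/\ (char_poly K)`_2 = 1, (char_poly K)`_1 = 0 &
    (char_poly K)`_0 = \det K].
  split; last by rewrite char_poly_det sqrrN expr1n mul1r.
    have /monicP := char_poly_monic K.
    by rewrite lead_coefE size_char_poly.
  by have := char_poly_trace K isT; rewrite trK oppr0.
case: i => [|[|[|i]]] /=; rewrite ?c2 ?c1 ?c0 ?addr0 ?add0r//.
by rewrite nth_default// size_char_poly.
Qed.

(** With respect to the inner product G G^T the form A is symmetric and
    traceless, so its two eigenvalues are opposite and, A being nonzero, not
    zero. In dimension two the inverse of a traceless operator is traceless. *)
Lemma traceless_sym_gram m (G : 'M[R]_(2, m)) (A : 'M[R]_2) :
  row_free G -> A^T = A -> A != 0 ->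
  \sum_i \sum_j invmx (G *m G^T) i j * A i j = 0 ->
  [/\ A \in unitmx, \tr (G *m G^T *m invmx A) = 0 &
      \det (G *m G^T *m invmx A) < 0].
Proof.
move=> fG symA A0; set H := G *m G^T => trA.
have symH : H^T = H by rewrite /H trmx_mul trmxK.
have posH (xi : 'rV_2) : xi != 0 -> 0 < dot (xi *m H) xi.
  move=> xi0; rewrite /H mulmxA dot_mull trmxK lt0r dot_ge0 andbT.
  by apply: contra_neq xi0; exact: dot_row_free.
have uH : H \in unitmx by exact: gram_unitmx.
clearbody H.
have H10 : H 1 0 = H 0 1 by rewrite -{1}symH mxE.
have A10 : A 1 0 = A 0 1 by rewrite -{1}symA mxE.
have [p00 p01 p10 p11] := invmx22 uH.
(* The quadratic form of H, tested below on (1, 0), which gives H 0 0 > 0, and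
   on (- H 0 1, H 0 0), which gives the determinant up to the factor H 0 0. *)
have qH x y : dot ((\row_j (if j == 0 then x else y)) *m H)
    (\row_j (if j == 0 then x else y))
    = H 0 0 * x ^+ 2 + 2 * H 0 1 * x * y + H 1 1 * y ^+ 2.
  by rewrite dotE big_ord2 !mxE !big_ord2 !mxE /= H10; ring.
have nz x y : (x != 0) || (y != 0) ->
    (\row_j (if j == 0 then x else y) : 'rV[R]_2) != 0.
  move=> xy; apply/eqP => /rowP E; have := E 0; have := E 1; rewrite !mxE /=.
  by move=> y0 x0; move: xy; rewrite y0 x0 eqxx.
have a0 : 0 < H 0 0.
  have /nz/posH : ((1 : R) != 0) || ((0 : R) != 0) by rewrite oner_eq0.
  by rewrite qH; lra.
have d0 : 0 < \det H.
  have /nz/posH : (- H 0 1 != 0) || (H 0 0 != 0) by rewrite (gt_eqF a0) orbT.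
  rewrite qH => h; rewrite det_mx22 H10 -(pmulr_rgt0 _ a0).
  by move: h; lra.
have T : H 1 1 * A 0 0 - 2 * H 0 1 * A 0 1 + H 0 0 * A 1 1 = 0.
  have /(congr1 ( *%R (\det H))) := trA; rewrite mulr0 => <-.
  rewrite !big_ord2 !mulrDr !mulrA.
  by rewrite p00 p01 p10 p11 H10 A10; ring.
have c0 : 0 < H 1 1.
  by move: d0; rewrite det_mx22 H10; nra.
have e0 : \det A < 0.
  rewrite ltNge; apply/negP => e0; move/negP: A0; apply.
  (* Eliminating A 0 0 by the trace condition T turns the determinant into
     minus a positive definite form in A 0 1 and A 1 1. *)
  have E : H 0 0 * H 1 1 * \det A
      = - ((H 0 0 * A 1 1 - H 0 1 * A 0 1) ^+ 2 + \det H * A 0 1 ^+ 2).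
    have -> : H 0 0 * H 1 1 * \det A = H 0 0 * A 1 1 * (H 1 1 * A 0 0)
        - H 0 0 * H 1 1 * A 0 1 ^+ 2 by rewrite det_mx22 A10; ring.
    have -> : H 1 1 * A 0 0 = 2 * H 0 1 * A 0 1 - H 0 0 * A 1 1 by lra.
    by rewrite det_mx22 H10; ring.
  have L : 0 <= H 0 0 * H 1 1 * \det A by rewrite !mulr_ge0// ltW.
  have S1 := sqr_ge0 (H 0 0 * A 1 1 - H 0 1 * A 0 1).
  have S2 : 0 <= \det H * A 0 1 ^+ 2 by rewrite mulr_ge0 ?sqr_ge0// ltW.
  have /eqP : \det H * A 0 1 ^+ 2 = 0 by lra.
  rewrite mulf_eq0 (gt_eqF d0) /= sqrf_eq0 => /eqP b0.
  have /eqP : (H 0 0 * A 1 1 - H 0 1 * A 0 1) ^+ 2 = 0 by lra.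
  rewrite sqrf_eq0 b0 mulr0 subr0 mulf_eq0 (gt_eqF a0) /= => /eqP A11.
  move: T; rewrite b0 A11 !mulr0 subr0 addr0 => /eqP.
  rewrite mulf_eq0 (gt_eqF c0) /= => /eqP A00.
  apply/eqP/matrixP => i j; rewrite mxE.
  case: i => [[|[|//]] i]; case: j => [[|[|//]] j].
  - by rewrite -A00; congr (A _ _); apply/val_inj.
  - by rewrite -b0; congr (A _ _); apply/val_inj.
  - by rewrite -b0 -A10; congr (A _ _); apply/val_inj.
  - by rewrite -A11; congr (A _ _); apply/val_inj.
have uA : A \in unitmx by rewrite unitmxE unitfE lt_eqF.
split=> //.
  have [q00 q01 q10 q11] := invmx22 uA.
  apply: (@mulfI _ (\det A)); first by rewrite lt_eqF.
  rewrite mulr0 -[RHS]T.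
  rewrite /mxtrace big_ord2 !mxE !big_ord2; set q := invmx A in q00 q01 q10 q11 *.
  transitivity (H 0 0 * (\det A * q 0 0) + H 0 1 * (\det A * q 1 0)
    + (H 1 0 * (\det A * q 0 1) + H 1 1 * (\det A * q 1 1))); first by ring.
  by rewrite q00 q01 q10 q11 H10 A10; ring.
by rewrite det_mulmx det_inv pmulr_rlt0// invr_lt0.
Qed.

(** Gaussian elimination extends the row space of A to a basis of the whole
    space, of which A spans the first k vectors; E consists of the others. *)
Lemma complete_frame k l (A : 'M[R]_(k, k + l)) : row_free A ->
  exists E : 'M[R]_(l, k + l), col_mx A E \in unitmx.
Proof.
move=> /eqP rA; have := mulmx_ebase A; rewrite rA.
have := row_ebase_unit A; set Q := row_ebase A => uQ AE.
have pE : pid_mx k = row_mx 1%:M 0 :> 'M[R]_(k, k + l).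
  by rewrite -pid_mx_row.
exists (dsubmx Q).
have AQ : A = col_ebase A *m usubmx Q.
  rewrite -{1}AE pE mul_mx_row mulmx1 mulmx0 -{1}[Q]vsubmxK.
  by rewrite mul_row_col mul0mx addr0.
have -> : col_mx A (dsubmx Q) = block_mx (col_ebase A) 0 0 1%:M *m Q.
  by rewrite -[Q in RHS]vsubmxK mul_block_col !mul0mx mul1mx addr0 add0r -AQ.
rewrite unitmx_mul uQ andbT unitmxE det_ublock det1 mulr1 -unitmxE.
exact: col_ebase_unit.
Qed.

End LinearAlgebra.

(** * Algebra of the shape operator *)

Section NormalFrame.
Variables (R : realType) (n : nat) (x f : 'rV[R]_(n.+2)) (X : 'M[R]_(n, n.+2)).
Hypotheses (fX : row_free X) (xx : dot x x = 1) (ff : dot f f = 1).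
Hypotheses (xf : dot x f = 0) (xX : x *m X^T = 0) (fX0 : f *m X^T = 0).

Let dot_x_span z : dot x (z *m X) = 0.
Proof. by rewrite dot_mulr xX dot0l. Qed.

Let dot_f_span z : dot f (z *m X) = 0.
Proof. by rewrite dot_mulr fX0 dot0l. Qed.

(** The vectors x and f and the n independent rows of X, orthogonal to both, form
    a basis of R^(n+2). *)
Lemma orthogonal_decomposition w :
  exists z, w = dot w x *: x + dot w f *: f + z *m X.
Proof.
pose M : 'M[R]_(n.+2) := col_mx (col_mx x f) X.
have comb (t : 'rV[R]_(n.+2)) : exists (a b : R) z,
    (t = row_mx (row_mx a%:M b%:M) z :> 'rV_(1 + 1 + n)) /\
    t *m M = a *: x + b *: f + z *m X.
  pose t' : 'rV[R]_(1 + 1 + n) := t.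
  have tE : t = row_mx (row_mx (lsubmx (lsubmx t') 0 0)%:M
      (rsubmx (lsubmx t') 0 0)%:M) (rsubmx t') :> 'rV_(1 + 1 + n).
    by rewrite -!mx11_scalar !hsubmxK.
  exists (lsubmx (lsubmx t') 0 0), (rsubmx (lsubmx t') 0 0), (rsubmx t').
  split; first exact: tE.
  rewrite [LHS](congr1 (fun s : 'rV[R]_(1 + 1 + n) => s *m M) tE).
  by rewrite mul_row_col mul_row_col !mul_scalar_mx.
have fx : dot f x = 0 by rewrite dotC.
have coef_x (a b : R) z : dot x (a *: x + b *: f + z *m X) = a.
  by rewrite !dotDr !dotZr xx xf dot_x_span mulr1 mulr0 !addr0.
have coef_f (a b : R) z : dot f (a *: x + b *: f + z *m X) = b.
  by rewrite !dotDr !dotZr ff fx dot_f_span mulr1 mulr0 addr0 add0r.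
have uM : M \in unitmx.
  rewrite -row_free_unit; apply: inj_row_free => t.
  have [a [b [z [-> ->]]]] := comb t => E.
  have a0 : a = 0 by rewrite -(coef_x a b z) E dot0r.
  have b0 : b = 0 by rewrite -(coef_f a b z) E dot0r.
  move: E; rewrite a0 b0 !scale0r !add0r => zX.
  have -> : z = 0 by apply: (row_free_inj fX); rewrite zX mul0mx.
  by rewrite !raddf0 !row_mx0.
have [a [b [z [_]]]] := comb (w *m invmx M).
rewrite mulmxKV// => ->; exists z.
by rewrite ![dot (_ + _) _]dotC coef_x coef_f.
Qed.

(** A hypersurface of the sphere has only one normal line. *)
Lemma normal_line v : dot v x = 0 -> v *m X^T = 0 -> v = dot v f *: f.
Proof.
move=> vx vX; have [z E] := orthogonal_decomposition v.
have z0 : z = 0.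
  apply: (dot_row_free fX).
  have := congr1 (fun w => dot (z *m X) w) E; rewrite !dotDr !dotZr.
  rewrite [dot _ v]dotC dot_mulr vX dot0l ![dot (z *m X) _]dotC.
  by rewrite dot_x_span dot_f_span !mulr0 !add0r.
by rewrite {1}E vx z0 mul0mx scale0r add0r addr0.
Qed.

Lemma tangent_sub k (G : 'M[R]_(k, n.+2)) :
  x *m G^T = 0 -> f *m G^T = 0 -> (G <= X)%MS.
Proof.
move=> xG fG; apply/row_subP => i.
have r0 (w : 'rV[R]_(n.+2)) : w *m G^T = 0 -> dot (row i G) w = 0.
  by move=> wG; rewrite rowE dotC dot_mulr wG dot0l.
have [z ->] := orthogonal_decomposition (row i G).
by rewrite !r0// !scale0r !add0r submxMl.
Qed.

End NormalFrame.

(** The rows of G are tangent to the hypersurface, G = L X, so that the shape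
    operator is - c P L. By the Weingarten equation X G^T = - P A one has
    L P = - G G^T A^-1, a traceless matrix of negative determinant, and P L has
    the same nonzero spectrum. *)
Lemma char_poly_gauss_shape (R : realType) (x f : 'rV[R]_6) (X : 'M[R]_(4, 6))
    (G : 'M[R]_(2, 6)) (P : 'M[R]_(4, 2)) (A : 'M[R]_2) (c : R) :
  row_free X -> dot x x = 1 -> dot f f = 1 -> dot x f = 0 ->
  x *m X^T = 0 -> f *m X^T = 0 -> x *m G^T = 0 -> f *m G^T = 0 ->
  row_free G -> A^T = A -> A != 0 ->
  \sum_i \sum_j invmx (G *m G^T) i j * A i j = 0 ->
  X *m G^T = - (P *m A) -> c ^+ 2 = 1 ->
  exists a : R, char_poly (- (c *: (P *m G *m X^T)) *m invmx (X *m X^T))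
    = 'X^2 * ('X^2 - (a ^+ 2)%:P).
Proof.
move=> fX xx ff xf xX fX0 xG fG0 fG symA A0 trA XG c2.
have [uA tr0 dneg] := traceless_sym_gram fG symA A0 trA.
have /submxP[L GL] := tangent_sub fX xx ff xf xX fX0 xG fG0.
set K := _ *m invmx A in tr0 dneg.
have LP : L *m P = - K.
  have : G *m G^T = - (L *m P *m A).
    by rewrite {1}GL -[L *m X *m _]mulmxA XG mulmxN mulmxA.
  by rewrite /K => ->; rewrite mulNmx mulmxK// opprK.
have -> : - (c *: (P *m G *m X^T)) *m invmx (X *m X^T) = P *m (- c *: L).
  rewrite GL mulmxA -scaleNr -scalemxAl -mulmxA mulmxK ?gram_unitmx//.
  by rewrite -scalemxAr.
have trLP : \tr ((- c *: L) *m P) = 0.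
  by rewrite -scalemxAl LP mxtraceZ raddfN /= tr0 oppr0 mulr0.
have dLP : \det ((- c *: L) *m P) = \det K.
  by rewrite -scalemxAl LP scalerN scaleNr opprK detZ c2 mul1r.
(* The characteristic polynomial of - c L P is 'X^2 + det K, with det K < 0. *)
exists (Num.sqrt (- \det K)); rewrite sqr_sqrtr ?oppr_ge0 ?ltW//.
have := char_poly_mulmxC P (- c *: L).
rewrite (char_poly_traceless22 trLP) dLP (_ : 'X^4 = 'X^2 * 'X^2); last first.
  by rewrite -exprD.
rewrite mulrC -mulrA => /mulfI -> //.
  by rewrite polyCN opprK.
by rewrite expf_eq0 polyX_eq0.
Qed.

Section RMean.
Variables (R : realType) (m : nat) (f : 'rV[R]_4 -> 'rV[R]_m) (u : 'rV[R]_4).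
Variables (nu : 'rV[R]_m) (a : R).
Hypothesis shape_char :
  char_poly (shape_operator f u nu) = 'X^2 * ('X^2 - (a ^+ 2)%:P).

Definition opposite_pair (i : 'I_4) : R := [:: 0; 0; a; - a]`_i.

Lemma principal_opposite_pair : principal_curvatures f u nu opposite_pair.
Proof.
rewrite /principal_curvatures shape_char !big_ord_recl big_ord0 /opposite_pair /=.
by rewrite polyCN polyC_exp; ring.
Qed.

Lemma r_mean_curvature1 : r_mean_curvature f u nu 1 0.
Proof.
exists opposite_pair; first exact: principal_opposite_pair.
rewrite big_cards1.
under eq_bigr do rewrite big_set1.
by rewrite !big_ord_recl big_ord0 /opposite_pair /= addr0 !add0r subrr mulr0.
Qed.

(** Only two of the four principal curvatures are nonzero, so every product of
    three or more of them vanishes. *)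
Lemma r_mean_curvature_ge3 r : (2 < r)%N -> r_mean_curvature f u nu r 0.
Proof.
move=> r3; exists opposite_pair; first exact: principal_opposite_pair.
rewrite big1 ?mulr0// => I /eqP cI.
have [i iI i2] : exists2 i : 'I_4, i \in I & (i < 2)%N.
  have : ~~ (I \subset [set i : 'I_4 | (2 <= i)%N]%SET).
    apply/negP => /subset_leq_card; rewrite cI.
    suff -> : #|[set i : 'I_4 | (2 <= i)%N]%SET| = 2%N by rewrite leqNgt r3.
    by rewrite -sum1dep_card big_mkcond !big_ord_recl big_ord0.
  by move=> /subsetPn[i iI]; rewrite inE -ltnNge => i2; exists i.
rewrite (bigD1 i)//= /opposite_pair.
by case: i iI i2 => [[|[|//]]] /= *; rewrite mul0r.
Qed.

End RMean.

(** * An immersed manifold in local coordinates *)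

Lemma chart_of_cont (R : realType) n (T : topologicalType) (A : set T)
    (c : chart R n T) u :
  chart_of A c -> cod c u -> {for u, continuous (param c)}.
Proof.
move=> [_ oc _ _ [_ pc]] cu.
by move: pc; rewrite continuous_open_subspace// => /(_ u); apply; exact: mem_set.
Qed.

Section Immersion.
Variables (R : realType) (n m : nat) (M : topologicalType).
Variables (atlas : set (chart R n M)) (g : M -> 'rV[R]_m).
Hypothesis Mm : smooth_manifold atlas.
Hypothesis gi : sphere_immersion setT atlas g.
Implicit Types (b c : chart R n M) (p : M).

Lemma atlas_chart_of c : atlas c -> chart_of setT c.
Proof. by case: Mm => _ + _ _; apply. Qed.

Lemma open_dom c : atlas c -> open (dom c).
Proof. by move=> /atlas_chart_of [] [W oW ->] _ _ _ _; rewrite setTI. Qed.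

Lemma open_cod c : atlas c -> open (cod c).
Proof. by move=> /atlas_chart_of[]. Qed.

Lemma coordK c p : atlas c -> dom c p -> cod c (c p) /\ param c (c p) = p.
Proof. by move=> /atlas_chart_of[_ _ + _ _] => /(_ p); apply. Qed.

Lemma paramK c u : atlas c -> cod c u -> dom c (param c u) /\ c (param c u) = u.
Proof. by move=> /atlas_chart_of[_ _ _ + _] => /(_ u); apply. Qed.

Lemma coord_cont c p : atlas c -> dom c p -> {for p, continuous c}.
Proof.
move=> ac cp; have [_ _ _ _ [+ _]] := atlas_chart_of ac.
rewrite continuous_open_subspace; last exact: open_dom.
by move=> /(_ p); apply; exact: mem_set.
Qed.

Lemma param_cont c u : atlas c -> cod c u -> {for u, continuous (param c)}.
Proof. by move=> /atlas_chart_of; exact: chart_of_cont. Qed.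

Lemma exists_chart p : exists2 b, atlas b & dom b p.
Proof. by case: Mm => _ _ + _; apply. Qed.

Definition overlap c b := cod c `&` param c @^-1` dom b.

Lemma overlapP c b p : atlas c -> dom c p -> dom b p -> overlap c b (c p).
Proof. by move=> ac cp bp; have [? E] := coordK ac cp; split; rewrite //= E. Qed.

Lemma open_overlap c b : atlas c -> atlas b -> open (overlap c b).
Proof.
move=> ac ab; have := param_cont ac => pc.
have : {in cod c, continuous (param c)} by move=> u /set_mem; exact: pc.
by rewrite continuous_inP; [apply; exact: open_dom|exact: open_cod].
Qed.

Lemma smooth_transition c b : atlas c -> atlas b ->
  smooth_on (overlap c b) (b \o param c).
Proof. by move=> ac ab; case: Mm => _ _ _; apply. Qed.

Lemma transition_cod c b u : atlas b -> overlap c b u -> cod b (b (param c u)).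
Proof. by move=> ab [_ bu]; have [] := coordK ab bu. Qed.

Local Notation loc b := (g \o param b).

Lemma loc_transition c b u : atlas b -> overlap c b u ->
  loc c u = (loc b \o (b \o param c)) u.
Proof. by move=> ab [_ bu] /=; have [_ ->] := coordK ab bu. Qed.

Lemma loc_smooth b : atlas b -> smooth_on (cod b) (loc b).
Proof. by case: gi => _ + _ => h /h. Qed.

Lemma loc_free b u : atlas b -> cod b u -> row_free ('J (loc b) u).
Proof. by case: gi => _ _ + ab bu; apply. Qed.

Lemma loc_unit b u : dot (loc b u) (loc b u) = 1.
Proof. by case: gi => + _ _; apply. Qed.

Lemma loc_tangent b u : atlas b -> cod b u -> loc b u *m ('J (loc b) u)^T = 0.
Proof.
move=> ab bu; have df := smooth_on_differentiable (loc_smooth ab) bu.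
apply/rowP => k; rewrite mulmx_tr_dot row_id jacobianE// mxE.
have nu : \forall y \near u, dot (loc b y) (loc b y) = 1.
  by near=> y; exact: loc_unit.
have := derive_dot_cst (delta_mx 0 k) df df nu; rewrite dotC => E.
by move: E; set a := dot _ _ => E; rewrite -/a; lra.
Unshelve. all: by end_near. Qed.

Definition normal_at p (V : 'rV[R]_m) :=
  dot V (g p) = 0 /\ forall w, tangent_image atlas g p w -> dot V w = 0.

Lemma dot_diff_loc c b p xi V : atlas c -> atlas b -> dom c p -> dom b p ->
  dot V ('d (loc c) (c p) xi)
    = dot (V *m ('J (loc b) (b p))^T) (xi *m 'J (b \o param c) (c p)).
Proof.
move=> ac ab cp bp; have ov := overlapP ac cp bp.
have [cc cpE] := coordK ac cp; have [bc _] := coordK ab bp.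
have dc := smooth_on_differentiable (loc_smooth ac) cc.
have db := smooth_on_differentiable (loc_smooth ab) bc.
have dt := smooth_on_differentiable (smooth_transition ac ab) ov.
have tE : (b \o param c) (c p) = b p by rewrite /= cpE.
rewrite -(deriveE xi dc) (deriveEjacobian xi dc).
rewrite (_ : 'J (loc c) (c p) = 'J (b \o param c) (c p) *m 'J (loc b) (b p)).
  by rewrite mulmxA dot_mulr.
have db' : differentiable (loc b) ((b \o param c) (c p)) by rewrite tE.
have := jacobian_comp dt db'; rewrite tE => <-.
apply: (near_eq_jacobian _ dc); near=> x; apply: loc_transition => //.
by near: x; exact: open_nbhs_nbhs (conj (open_overlap ac ab) ov).
Unshelve. all: by end_near. Qed.

(** The tangent vectors are defined through all the charts of M; by the chain
    rule those of one chart suffice. *)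
Lemma tangent_normalP b p V : atlas b -> dom b p ->
  (forall w, tangent_image atlas g p w -> dot V w = 0)
    <-> V *m ('J (loc b) (b p))^T = 0.
Proof.
move=> ab bp; have [bc _] := coordK ab bp.
have db := smooth_on_differentiable (loc_smooth ab) bc.
split=> [nV|V0 w [c [xi [ac cp ->]]]]; last first.
  by rewrite (dot_diff_loc xi V ac ab cp bp) V0 dot0l.
apply/rowP => k; rewrite mulmx_tr_dot row_id jacobianE// mxE.
by apply: nV; exists b, (delta_mx 0 k); split => //; rewrite deriveE.
Qed.

(** The chain rule for the transition map, in the form of [derive2_comp_normal];
    the projection in [second_form] does not affect products with normal vectors. *)
Lemma dot_second_form c b p xi eta V : atlas c -> atlas b -> dom c p ->
  dom b p -> normal_at p V ->
  dot V (second_form (loc c) (c p) xi eta)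
    = dot (xi *m 'J (b \o param c) (c p) *m normal_hessian (loc b) (b p) V)
        (eta *m 'J (b \o param c) (c p)).
Proof.
move=> ac ab cp bp [Vg Vt]; have ov := overlapP ac cp bp.
have [cc cpE] := coordK ac cp.
have V0 b' : atlas b' -> dom b' p -> V *m ('J (loc b') (b' p))^T = 0.
  by move=> ab' bp'; exact/tangent_normalP.
have tE : (b \o param c) (c p) = b p by rewrite /= cpE.
rewrite /second_form dot_normal_proj; last first.
  rewrite tr_col_mx mul_mx_row V0// (_ : V *m _^T = 0) ?row_mx0//.
  apply/rowP => k; rewrite mulmx_tr_dot !row_id mxE /= cpE.
  exact: Vg.
rewrite -tE.
rewrite -(derive2_comp_normal (open_cod ab) (loc_smooth ab) xi eta
  (open_overlap ac ab) (smooth_transition ac ab) ov); last 2 first.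
- exact: transition_cod.
- by rewrite tE; exact: V0.
apply: (congr1 (dot V)).
apply: (@near_eq_derive _ _ _ (fun x => 'D_eta (loc c) x)
  (fun x => 'D_eta (loc b \o (b \o param c)) x) (c p) xi).
near=> x; apply: near_eq_derive.
have ox : overlap c b x.
  by near: x; exact: open_nbhs_nbhs (conj (open_overlap ac ab) ov).
near=> y; apply: loc_transition => //.
by near: y; exact: open_nbhs_nbhs (conj (open_overlap ac ab) ox).
Unshelve. all: by end_near. Qed.

Lemma dot_second_form_frame b p V l k : atlas b -> dom b p -> normal_at p V ->
  dot V (second_form (loc b) (b p) (delta_mx 0 l) (delta_mx 0 k))
    = normal_hessian (loc b) (b p) V l k.
Proof.
move=> ab bp nV; have [bc bE] := coordK ab bp.
rewrite /second_form dot_normal_proj ?mxE//.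
rewrite tr_col_mx mul_mx_row ((tangent_normalP V ab bp).1 nV.2).
rewrite (_ : V *m _^T = 0) ?row_mx0//; apply/rowP => j.
by rewrite mulmx_tr_dot !row_id mxE /= bE; exact: nV.1.
Qed.

(** A vector of the normal space is orthogonal to the second fundamental form as
    soon as it is so in one chart, by [dot_second_form]. *)
Lemma normal_hessian_star b p V : atlas b -> dom b p -> normal_at p V ->
  (forall w, linear_span (second_form_values atlas g p) w -> dot V w = 0)
    <-> normal_hessian (loc b) (b p) V = 0.
Proof.
move=> ab bp nV; split=> [sp|A0 w [k [a [v [vS ->]]]]]; last first.
  rewrite dot_sumr big1// => i _; have [c [xi [eta [ac cp ->]]]] := vS i.
  by rewrite dotZr (dot_second_form xi eta ac ab cp bp nV) A0 mulmx0 dot0l mulr0.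
apply/matrixP => l k; rewrite [RHS]mxE.
pose w := second_form (loc b) (b p) (delta_mx 0 l) (delta_mx 0 k).
have <- : dot V w = normal_hessian (loc b) (b p) V l k.
  exact: dot_second_form_frame.
apply: sp; exists 1%N, (fun=> 1), (fun=> w).
split; last by rewrite big_ord1 scale1r.
by move=> _; exists b, (delta_mx 0 l), (delta_mx 0 k).
Qed.

Lemma bundle_normal (q : M * 'rV[R]_m) :
  unit_normal_bundle atlas g q -> normal_at q.1 q.2.
Proof. by move=> [_ ? ?]. Qed.

Lemma star_hessian (q : M * 'rV[R]_m) b :
  unit_normal_bundle atlas g q -> atlas b -> dom b q.1 ->
  unit_normal_bundle_star atlas g q
    <-> normal_hessian (loc b) (b q.1) q.2 != 0.
Proof.
move=> Nq ab bq; have E := normal_hessian_star ab bq (bundle_normal Nq).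
split=> [[_ nE]|/eqP nE]; last by split => // /E.
by apply/eqP => /E.
Qed.

End Immersion.

(** * The Gauss image of the normal bundle *)

Section NormalBundle.
Variables (R : realType) (M : topologicalType).
Variables (atlas : set (chart R 2 M)) (h : chart R 2 M -> 'rV[R]_2 -> 'M[R]_2).
Variable g : M -> 'rV[R]_6.
Hypotheses (Mm : smooth_manifold atlas) (gi : sphere_immersion setT atlas g).
Hypotheses (giso : isometric atlas h g) (gmin : minimal_immersion atlas h g).

Local Notation N := (unit_normal_bundle atlas g).
Local Notation Nstar := (unit_normal_bundle_star atlas g).
Local Notation charts := (submanifold_charts 4 atlas Nstar).
Local Notation loc b := (g \o param b).

(** Minimality of g, paired with the normal vector V. *)
Lemma trace_normal_hessian b p V : atlas b -> dom b p -> normal_at atlas g p V ->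
  \sum_i \sum_j invmx ('J (loc b) (b p) *m ('J (loc b) (b p))^T) i j
    * normal_hessian (loc b) (b p) V i j = 0.
Proof.
move=> ab bp nV; have [bc _] := coordK Mm ab bp.
have := congr1 (dot V) (gmin ab bc); rewrite dot0r dot_sumr (giso ab bc) => E.
rewrite -[RHS]E.
apply: eq_bigr => i _; rewrite dot_sumr; apply: eq_bigr => j _.
by rewrite dotZr (dot_second_form_frame Mm gi i j ab bp nV).
Qed.

Section GaussImage.
Variables (c : chart R 4 (M * 'rV[R]_6)%type) (b : chart R 2 M).
Hypotheses (cc : charts c) (ab : atlas b).

Let W := cod c `&` [set t | dom b (param c t).1].
Let phi t := b (param c t).1.
Let x t : 'rV[R]_6 := (param c t).2.
Let Y t := row_mx (phi t) (x t).

Lemma open_gauss_dom : open W.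
Proof.
have [cch _] := cc; have oc : open (cod c) by case: cch.
have fc : {in cod c, continuous (fun t => (param c t).1)}.
  move=> t /set_mem ct; apply: continuous_comp (chart_of_cont cch ct) _.
  exact: cvg_fst.
have := continuous_inP _ oc; move=> /(_ _ (fun t => (param c t).1))[+ _].
by move=> /(_ fc); apply; exact: open_dom Mm _ ab.
Qed.

Let Ys : smooth_on W Y.
Proof. by have [_ /(_ b ab)[]] := cc. Qed.

Let phiE : phi = lsubmx \o Y.
Proof. by apply/funext => t /=; rewrite row_mxKl. Qed.

Let xE : x = rsubmx \o Y.
Proof. by apply/funext => t /=; rewrite row_mxKr. Qed.

Lemma gauss_phi_smooth : smooth_on W phi.
Proof.
rewrite phiE; exact: (smooth_on_linear_comp (L := lsubmx) open_gauss_dom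
  (@continuous_lsubmx _ _ _ _) Ys).
Qed.

Lemma gauss_x_smooth : smooth_on W x.
Proof.
rewrite xE; exact: (smooth_on_linear_comp (L := rsubmx) open_gauss_dom
  (@continuous_rsubmx _ _ _ _) Ys).
Qed.

(** The inverse of a chart of N_* is an immersion into M x R^6, so the
    differentials of the base point and of x have no common kernel. *)
Lemma gauss_jacobian_inj t (z : 'rV[R]_4) : W t ->
  z *m 'J phi t = 0 -> z *m 'J x t = 0 -> z = 0.
Proof.
move=> Wt zP zX; have [_ /(_ b ab)[_ /(_ t Wt) free]] := cc.
have dY := smooth_on_differentiable Ys Wt.
apply: (row_free_inj free); rewrite mul0mx /= -['J _ t]hsubmxK.
rewrite -(jacobian_lsubmx dY) -(jacobian_rsubmx dY) -phiE -xE.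
by rewrite mul_mx_row zP zX row_mx0.
Qed.

Lemma gauss_star t : W t -> Nstar (param c t).
Proof.
move=> [ct _]; have [[[? _ domE] _ _ /(_ t ct)[+ _] _] _] := cc.
by rewrite domE => -[].
Qed.

Let Wcod t : W t -> cod b (phi t).
Proof. by move=> [_ bt]; have [] := coordK Mm ab bt. Qed.

Lemma gauss_unit t : W t -> dot (x t) (x t) = 1.
Proof. by move=> /gauss_star[[]]. Qed.

Lemma gauss_normal t : W t -> normal_at atlas g (param c t).1 (x t).
Proof. by move=> /gauss_star[/bundle_normal]. Qed.

Lemma gauss_dot_loc t : W t -> dot (x t) (loc b (phi t)) = 0.
Proof.
move=> Wt; have [+ _] := gauss_normal Wt.
by have [_ bt] := Wt; have [_ /= ->] := coordK Mm ab bt.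
Qed.

Lemma gauss_tangent t : W t -> x t *m ('J (loc b) (phi t))^T = 0.
Proof.
move=> Wt; have [_ nt] := gauss_normal Wt; have [_ bt] := Wt.
exact/(tangent_normalP Mm gi _ ab bt).
Qed.

Let Wnear t (Q : 'rV[R]_4 -> Prop) : W t -> (forall s, W s -> Q s) ->
  \forall s \near t, Q s.
Proof.
move=> Wt WQ; near=> s; apply: WQ; near: s.
exact: open_nbhs_nbhs (conj open_gauss_dom Wt).
Unshelve. all: by end_near. Qed.

Lemma gauss_self_tangent t : W t -> x t *m ('J x t)^T = 0.
Proof.
move=> Wt; have dx := smooth_on_differentiable gauss_x_smooth Wt.
apply/rowP => k; rewrite mulmx_tr_dot row_id jacobianE// mxE.
have := derive_dot_cst (delta_mx 0 k) dx dx (Wnear Wt gauss_unit); rewrite dotC.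
by set a := dot _ _ => E; lra.
Qed.

Let loc_phi_smooth : smooth_on W (loc b \o phi).
Proof.
exact: smooth_on_comp open_gauss_dom (open_cod Mm ab) Wcod gauss_phi_smooth
  (loc_smooth gi ab).
Qed.

Let derive_loc_phi t i : W t -> 'D_(delta_mx 0 i) (loc b \o phi) t
  = row i ('J phi t *m 'J (loc b) (phi t)).
Proof.
move=> Wt; rewrite -jacobian_comp.
- by rewrite jacobianE//; exact: smooth_on_differentiable loc_phi_smooth Wt.
- exact: smooth_on_differentiable gauss_phi_smooth Wt.
- exact: smooth_on_differentiable (loc_smooth gi ab) (Wcod Wt).
Qed.

(** The position vector of g is normal to the hypersurface: x is orthogonal to
    f o phi and to the differential of f o phi. *)
Lemma gauss_loc_normal t : W t -> loc b (phi t) *m ('J x t)^T = 0.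
Proof.
move=> Wt; have dx := smooth_on_differentiable gauss_x_smooth Wt.
have df := smooth_on_differentiable loc_phi_smooth Wt.
apply/rowP => k; rewrite mulmx_tr_dot row_id jacobianE// mxE dotC.
rewrite (derive_dot_cst (delta_mx 0 k) dx df (Wnear Wt gauss_dot_loc)).
by rewrite derive_loc_phi// row_mul dot_mulr gauss_tangent// dot0l oppr0.
Qed.

(** The Weingarten equation: x stays orthogonal to the partial derivatives of
    f at phi, and differentiating this relation moves one derivative from x to
    f. *)
Lemma gauss_weingarten t : W t -> 'J x t *m ('J (loc b) (phi t))^T
  = - ('J phi t *m normal_hessian (loc b) (phi t) (x t)).
Proof.
move=> Wt; have dx := smooth_on_differentiable gauss_x_smooth Wt.
have dp := smooth_on_differentiable gauss_phi_smooth Wt.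
have ct := Wcod Wt; have fs := loc_smooth gi ab.
apply/matrixP => i k; rewrite mulmx_tr_dot jacobianE// jacobianE; last first.
  exact: smooth_on_differentiable fs ct.
pose Dk s := 'D_(delta_mx 0 k) (loc b) s.
have Dks : smooth_on (cod b) Dk := smooth_on_derive _ fs.
have dDk := smooth_on_differentiable Dks ct.
have dG : differentiable (Dk \o phi) t := differentiable_comp dp dDk.
have near0 : \forall s \near t, dot (x s) ((Dk \o phi) s) = 0.
  apply: Wnear Wt _ => s Ws.
  have := congr1 (fun A : 'rV[R]_2 => A 0 k) (gauss_tangent Ws).
  rewrite mulmx_tr_dot row_id [RHS]mxE jacobianE; first by [].
  exact: smooth_on_differentiable fs (Wcod Ws).
rewrite (derive_dot_cst (delta_mx 0 i) dx dG near0) mxE; congr (- _).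
rewrite (deriveE _ dG) (diff_comp dp dDk) /= -(deriveE _ dDk).
rewrite (dot_derive_partial fs)//.
by rewrite -(deriveE _ dp) -jacobianE// -row_mul mxE.
Qed.

Lemma gauss_hessian_neq0 t : W t -> normal_hessian (loc b) (phi t) (x t) != 0.
Proof.
move=> Wt; have Nt := gauss_star Wt; have [_ bt] := Wt.
by apply/(star_hessian Mm gi Nt.1 ab bt).
Qed.

Let hessian_sym t : W t -> (normal_hessian (loc b) (phi t) (x t))^T
  = normal_hessian (loc b) (phi t) (x t).
Proof.
move=> /Wcod ct.
exact: (normal_hessian_sym (open_cod Mm ab) (loc_smooth gi ab) _ ct).
Qed.

Let hessian_trace t : W t -> let G := 'J (loc b) (phi t) in
  \sum_i \sum_j invmx (G *m G^T) i j * normal_hessian (loc b) (phi t) (x t) i j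
  = 0.
Proof.
move=> Wt; have [_ bt] := Wt; exact: trace_normal_hessian (gauss_normal Wt).
Qed.

(** By the Weingarten equation a vector killed by the differential of x is sent
    by the differential of phi into the kernel of the second fundamental form
    of g in the direction x; on N_* this form is nondegenerate. *)
Lemma gauss_free t : W t -> row_free ('J x t).
Proof.
move=> Wt; have [uA _ _] := traceless_sym_gram (loc_free gi ab (Wcod Wt))
  (hessian_sym Wt) (gauss_hessian_neq0 Wt) (hessian_trace Wt).
apply: inj_row_free => z zX; apply: (gauss_jacobian_inj Wt) => //.
have := congr1 (mulmx z) (gauss_weingarten Wt).
rewrite mulmxA zX mul0mx mulmxN mulmxA => /eqP; rewrite eq_sym oppr_eq0 => /eqP.
by move=> /(congr1 (mulmx^~ (invmx (normal_hessian (loc b) (phi t) (x t)))));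
  rewrite mul0mx mulmxK.
Qed.

(** A unit normal nu of the hypersurface is plus or minus the position vector of
    g, and <d_i d_j x, f> = - <d_j x, d_i (f o phi)>, so that the shape operator
    is the one computed in [char_poly_gauss_shape]; k is the sign. *)
Lemma gauss_shape t nu : W t -> dot nu nu = 1 -> dot nu (x t) = 0 ->
  nu *m ('J x t)^T = 0 ->
  exists a : R, char_poly (shape_operator x t nu) = 'X^2 * ('X^2 - (a ^+ 2)%:P).
Proof.
move=> Wt nu1 nux nuX; have fX := gauss_free Wt.
have xx := gauss_unit Wt; have ff := loc_unit gi b (phi t).
have xf := gauss_dot_loc Wt; have xX := gauss_self_tangent Wt.
have fX0 := gauss_loc_normal Wt.
have nuE := normal_line fX xx ff xf xX fX0 nux nuX.
set k := dot nu _ in nuE.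
have k2 : k ^+ 2 = 1 by rewrite -nu1 nuE dotZl dotZr ff mulr1 expr2.
have [a aE] := char_poly_gauss_shape fX xx ff xf xX fX0 (gauss_tangent Wt)
  (loc_tangent gi ab (Wcod Wt)) (loc_free gi ab (Wcod Wt)) (hessian_sym Wt)
  (gauss_hessian_neq0 Wt) (hessian_trace Wt) (gauss_weingarten Wt) k2.
exists a; apply: etrans aE.
apply: (congr1 (fun B => char_poly (B *m invmx ('J x t *m ('J x t)^T)))).
apply/matrixP => i j; rewrite mxE dotC /second_form dot_normal_proj; last first.
  rewrite tr_col_mx mul_mx_row nuX (_ : nu *m _^T = 0) ?row_mx0//.
  by apply/rowP => l; rewrite mulmx_tr_dot !row_id nux mxE.
rewrite {1}nuE dotZl mxE mxE -mulrN; congr (_ * _).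
rewrite mulmx_tr_dot -derive_loc_phi//.
have dDx := smooth_on_differentiable
  (smooth_on_derive (delta_mx 0 j) gauss_x_smooth) Wt.
have df := smooth_on_differentiable loc_phi_smooth Wt.
have dx := smooth_on_differentiable gauss_x_smooth Wt.
rewrite jacobianE// dotC (derive_dot_cst (delta_mx 0 i) dDx df (c := 0)).
  by rewrite dotC.
apply: Wnear Wt _ => s Ws.
have := congr1 (fun A : 'rV[R]_4 => A 0 j) (gauss_loc_normal Ws).
rewrite mulmx_tr_dot row_id mxE jacobianE; first by rewrite dotC.
exact: smooth_on_differentiable gauss_x_smooth Ws.
Qed.

End GaussImage.
End NormalBundle.

(** * Open subsets of the normal bundle and their charts *)

Section Topology.
Variable R : realType.

Lemma open_preimage (T T' : topologicalType) (U : set T) (F : T -> T') X :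
  open U -> (forall t, U t -> {for t, continuous F}) -> open X ->
  open (U `&` F @^-1` X).
Proof.
move=> oU Fc oX; apply: (continuous_inP F oU).1 => // t /set_mem; exact: Fc.
Qed.

Lemma open_neq0 (T : topologicalType) (V : normedModType R) (U : set T)
    (F : T -> V) :
  open U -> (forall t, U t -> {for t, continuous F}) ->
  open (U `&` [set t | F t != 0]).
Proof.
move=> oU Fc; have := @open_preimage _ _ U (fun t => `|F t|) [set r | r != 0].
rewrite (_ : _ @^-1` _ = [set t | F t != 0]); last first.
  by apply/seteqP; split=> t /=; rewrite normr_eq0.
apply; [exact: oU| |exact: open_neq].
by move=> t Ut; apply: continuous_comp (Fc t Ut) (@norm_continuous _ _ _).
Qed.

Lemma cvg_row_mx (T : topologicalType) n1 n2 (F : T -> 'rV[R]_n1)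
    (G : T -> 'rV[R]_n2) t :
  {for t, continuous F} -> {for t, continuous G} ->
  {for t, continuous (fun s => row_mx (F s) (G s))}.
Proof.
move=> Fc Gc; apply/cvg_ballP => e e0; near=> s.
have [_ bF] : ball (F t) e (F s).
  by near: s; exact: (Fc _ (nbhsx_ballx _ _ e0)).
have [_ bG] : ball (G t) e (G s).
  by near: s; exact: (Gc _ (nbhsx_ballx _ _ e0)).
split=> // i j; case: (split_ordP j) => l ->.
  by rewrite !row_mxEl; exact: bF.
by rewrite !row_mxEr; exact: bG.
Unshelve. all: by end_near. Qed.

End Topology.

Section BundleCharts.
Variables (R : realType) (n k : nat) (M : topologicalType).
Let m := (1 + n + 1 + k)%N.
Variables (atlas : set (chart R n M)) (g : M -> 'rV[R]_m).
Hypotheses (Mm : smooth_manifold atlas) (gi : sphere_immersion setT atlas g).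

Local Notation N := (unit_normal_bundle atlas g).
Local Notation Nstar := (unit_normal_bundle_star atlas g).
Local Notation loc b := (g \o param b).

Lemma coord_pair_cont b (q : M * 'rV[R]_m) : atlas b -> dom b q.1 ->
  {for q, continuous (fun r : M * 'rV[R]_m => row_mx (b r.1) r.2)}.
Proof.
move=> ab bq; apply: cvg_row_mx; last exact: cvg_snd.
by apply: continuous_comp; [exact: cvg_fst|exact: coord_cont Mm _ _ ab bq].
Qed.

Lemma open_dom_fst b : atlas b -> open [set q : M * 'rV[R]_m | dom b q.1].
Proof.
move=> ab; apply: (@open_comp _ _ fst); last exact: open_dom Mm _ ab.
by move=> q _; exact: cvg_fst.
Qed.

Lemma open_bundle b (B : set 'rV[R]_(n + m)) : atlas b -> open B ->
  open [set q : M * 'rV[R]_m | dom b q.1 /\ B (row_mx (b q.1) q.2)].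
Proof.
move=> ab oB; apply: (open_preimage (open_dom_fst ab) _ oB) => q bq.
exact: coord_pair_cont.
Qed.

(** Its points (u, V) with V a unit normal vector at u are, in the coordinates of
    a chart of M, those of N_*. *)
Definition hessian_support b : set 'rV[R]_(n + m) :=
  lsubmx @^-1` cod b `&`
  [set y | normal_hessian (loc b) (lsubmx y) (rsubmx y) != 0].

Lemma open_lsubmx_cod n' b : atlas b ->
  open ((lsubmx : 'rV[R]_(n + n') -> _) @^-1` cod b).
Proof.
move=> ab; apply: open_comp (open_cod Mm ab) => y _.
exact: continuous_lsubmx.
Qed.

Lemma open_hessian_support b : atlas b -> open (hessian_support b).
Proof.
move=> ab; apply: open_neq0 (open_lsubmx_cod ab) _ => y Uy.
have := smooth_on_normal_hessian (open_lsubmx_cod ab) (open_cod Mm ab)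
  (fun _ h => h) (loc_smooth gi ab) (smooth_on_lsubmx _) (smooth_on_rsubmx _).
by move/smooth_on_continuous; exact.
Qed.

(** Openness is local in M, so the open set is the union over the charts of M of
    the sets on which the second fundamental form does not vanish. *)
Lemma star_open : exists2 O : set (M * 'rV[R]_m), open O & Nstar = N `&` O.
Proof.
exists [set q | exists2 b, atlas b &
    dom b q.1 /\ hessian_support b (row_mx (b q.1) q.2)].
  rewrite (_ : [set q | _] = \bigcup_(b in atlas) [set q : M * 'rV[R]_m |
    dom b q.1 /\ hessian_support b (row_mx (b q.1) q.2)]); last by [].
  by apply: bigcup_open => b ab; exact: open_bundle (open_hessian_support ab).
apply/seteqP; split=> [q Sq|q [Nq [b ab [bq [_ /=]]]]]; last first.
  rewrite row_mxKl row_mxKr => A0; exact/(star_hessian Mm gi Nq ab bq).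
split; first exact: Sq.1; have [b ab bq] := exists_chart Mm q.1.
exists b => //; split=> //; have [bc _] := coordK Mm ab bq.
split; first by rewrite /= row_mxKl.
rewrite /= row_mxKl row_mxKr; exact/(star_hessian Mm gi Sq.1 ab bq).
Qed.

Section Chart.
Variables (b : chart R n M) (q0 : M * 'rV[R]_m).
Hypotheses (ab : atlas b) (bq0 : dom b q0.1) (Sq0 : Nstar q0).

Let f := loc b.
Let V0 := q0.2.

Definition tangent_frame u : 'M[R]_(1 + n, m) := col_mx (f u) ('J f u).

Lemma tangent_frame_normal u V : cod b u ->
  V *m (tangent_frame u)^T = 0 <-> normal_at atlas g (param b u) V.
Proof.
move=> bu; have [bp bE] := paramK Mm ab bu.
have TP := tangent_normalP Mm gi V ab bp; rewrite bE in TP.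
rewrite /tangent_frame tr_col_mx mul_mx_row; split.
  move=> E; have [/(congr1 (fun A : 'M[R]_1 => A 0 0)) E1 E2] :
      V *m (f u)^T = 0 /\ V *m ('J f u)^T = 0.
    by apply: eq_row_mx; rewrite E row_mx0.
  split; last exact/TP.
  by move: E1; rewrite [RHS]mxE.
move=> [E1 /TP ->]; rewrite (_ : V *m _^T = 0) ?row_mx0//.
by apply/rowP => i; rewrite mulmx_tr_dot !row_id mxE.
Qed.

(** At the centre of the chart, f, the partial derivatives of f and V0 are
    independent; the frame E completes them. *)
Lemma exists_frame : exists E : 'M[R]_(k, m),
  col_mx (col_mx (tangent_frame (b q0.1)) V0) E \in unitmx.
Proof.
have [bc bE] := coordK Mm ab bq0.
apply: complete_frame; apply: inj_row_free => z.
have VT : V0 *m (tangent_frame (b q0.1))^T = 0.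
  apply/(tangent_frame_normal _ bc); rewrite bE.
  exact: bundle_normal Sq0.1.
have [V1 _ _] := Sq0.1.
rewrite -[z]hsubmxK mul_row_col; set y := lsubmx z; set d := rsubmx z => E.
have d0 : d = 0.
  rewrite [d]mx11_scalar; have := congr1 (dot V0) E.
  rewrite dotDr dot_mulr VT dot0l add0r dot0r [d in d *m _]mx11_scalar.
  by rewrite mul_scalar_mx dotZr V1 mulr1 => ->; rewrite raddf0.
move: E; rewrite d0 mul0mx addr0 -[y]hsubmxK mul_row_col.
set a := lsubmx y; set w := rsubmx y => E.
have a0 : a = 0.
  rewrite [a]mx11_scalar; have := congr1 (dot (f (b q0.1))) E.
  rewrite dotDr [dot _ (w *m _)]dot_mulr (loc_tangent gi ab bc) dot0l addr0.
  rewrite dot0r [in LHS](mx11_scalar a) mul_scalar_mx dotZr (loc_unit gi) mulr1.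
  by move=> ->; rewrite raddf0.
move: E; rewrite a0 mul0mx add0r => wJ.
have w0 : w = 0.
  by apply: (row_free_inj (loc_free gi ab bc)); rewrite mul0mx.
by rewrite w0 !row_mx0.
Qed.

Section Frame.
Variable E : 'M[R]_(k, m).
Hypothesis E_unit : col_mx (col_mx (tangent_frame (b q0.1)) V0) E \in unitmx.

Let frame u : 'M[R]_m := col_mx (col_mx (tangent_frame u) V0) E.

Let frame_dom : set 'rV[R]_n := cod b `&` [set u | \det (frame u) != 0].

Let frame_unit u : frame_dom u -> (frame u)^T \in unitmx.
Proof. by move=> [_ du]; rewrite unitmx_tr unitmxE unitfE. Qed.

Let frame_smooth : smooth_on (cod b) frame.
Proof.
have oc := open_cod Mm ab; have fs := loc_smooth gi ab.
apply: smooth_on_col_mx (smooth_on_cst _ _) => //.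
apply: smooth_on_col_mx (smooth_on_cst _ _) => //.
by apply: smooth_on_col_mx => //; exact: smooth_on_jacobian.
Qed.

Let open_frame_dom : open frame_dom.
Proof.
have oc := open_cod Mm ab.
apply: open_neq0 => // u bu.
exact: smooth_on_continuous (smooth_on_det oc frame_smooth) bu.
Qed.

Let dom0 : set 'rV[R]_(n + k) := lsubmx @^-1` frame_dom.

Let open_dom0 : open dom0.
Proof.
by apply: open_comp open_frame_dom => y _; exact: continuous_lsubmx.
Qed.

(** When the frame at u = lsubmx v is invertible, this is the only vector that is
    normal at u, has product 1 with V0 and products rsubmx v with the rows of E. *)
Definition fibre_point (v : 'rV[R]_(n + k)) : 'rV[R]_m :=
  row_mx (row_mx 0 1%:M) (rsubmx v) *m invmx (frame (lsubmx v))^T.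

(** The normal vectors V with <V, V0> > 0 correspond, by central projection, to
    the affine subspace <V, V0> = 1 of the normal space; the normalisation is the
    inverse of this projection on the unit sphere. *)
Definition unit_fibre_point v : 'rV[R]_m :=
  (Num.sqrt (dot (fibre_point v) (fibre_point v)))^-1 *: fibre_point v.

Definition fibre_coord (V : 'rV[R]_m) : 'rV[R]_k :=
  (dot V V0)^-1 *: (V *m E^T).

Let fibre_point_frame v : dom0 v -> [/\
  fibre_point v *m (tangent_frame (lsubmx v))^T = 0,
  dot (fibre_point v) V0 = 1 & fibre_point v *m E^T = rsubmx v].
Proof.
move=> Dv; have : fibre_point v *m (frame (lsubmx v))^T
    = row_mx (row_mx 0 1%:M) (rsubmx v).
  by rewrite mulmxKV// frame_unit.
rewrite tr_col_mx tr_col_mx !mul_mx_row => /eq_row_mx[/eq_row_mx[-> V1] ->].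
by split=> //; rewrite /dot V1 mxE.
Qed.

Let fibre_pointP v V : dom0 v -> V *m (tangent_frame (lsubmx v))^T = 0 ->
  dot V V0 = 1 -> V *m E^T = rsubmx v -> fibre_point v = V.
Proof.
move=> Dv VT V1 VE; rewrite /fibre_point -VE.
rewrite (_ : row_mx _ _ = V *m (frame (lsubmx v))^T) ?mulmxK ?frame_unit//.
rewrite tr_col_mx tr_col_mx !mul_mx_row VT; congr (row_mx (row_mx _ _) _).
by apply/matrixP => i j; rewrite !ord1 [RHS]V1 mxE.
Qed.

Let fibre_norm_gt0 v : dom0 v -> 0 < dot (fibre_point v) (fibre_point v).
Proof.
move=> /fibre_point_frame[_ V1 _]; rewrite lt0r dot_ge0 andbT dot_eq0.
by apply/eqP => w0; move: V1; rewrite w0 dot0l => /eqP; rewrite eq_sym oner_eq0.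
Qed.

Let fibre_smooth : smooth_on dom0 fibre_point.
Proof.
have sF : smooth_on dom0 (frame \o lsubmx).
  apply: smooth_on_comp open_dom0 (open_cod Mm ab) _ (smooth_on_lsubmx _)
    frame_smooth => v [].
  by [].
apply: smooth_on_mulmx => //.
  apply: smooth_on_row_mx => //; [exact: smooth_on_cst|exact: smooth_on_rsubmx].
apply: smooth_on_invmx => //; last exact: smooth_on_trmx.
by move=> v Dv; exact: frame_unit.
Qed.

Let unit_fibre_smooth : smooth_on dom0 unit_fibre_point.
Proof.
apply: smooth_on_scale => //; apply: smooth_on_rsqrt => //.
exact: smooth_on_dot.
Qed.

(** The coordinates of (p, V) are those of p in b and the products of the central
    projection of V with the rows of E. *)
Definition bundle_chart : chart R (n + k) (M * 'rV[R]_m)%type :=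
  Chart
    (Nstar `&` [set q | dom b q.1 /\
      (frame_dom (lsubmx (row_mx (b q.1) q.2)) /\
       0 < dot (rsubmx (row_mx (b q.1) q.2)) V0)])
    (dom0 `&`
      [set v | normal_hessian f (lsubmx v) (unit_fibre_point v) != 0])
    (fun q => row_mx (b q.1) (fibre_coord q.2))
    (fun v => (param b (lsubmx v), unit_fibre_point v)).

Let half_space : set 'rV[R]_(n + m) :=
  [set y | frame_dom (lsubmx y) /\ 0 < dot (rsubmx y) V0].

Let open_half_space : open half_space.
Proof.
have oL : open ((lsubmx : 'rV[R]_(n + m) -> _) @^-1` frame_dom).
  by apply: open_comp open_frame_dom => y _; exact: continuous_lsubmx.
apply: (open_preimage (F := fun y => dot (rsubmx y) V0) oL _ (open_gt (y := 0))).
move=> y; apply: smooth_on_continuous.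
exact: smooth_on_dot oL (smooth_on_rsubmx _) (smooth_on_cst _ _).
Qed.

Let unit_fibreK V v : dom0 v -> V *m (tangent_frame (lsubmx v))^T = 0 ->
  dot V V = 1 -> 0 < dot V V0 -> fibre_coord V = rsubmx v ->
  unit_fibre_point v = V.
Proof.
move=> Dv VT VV V1 VE; have a0 : dot V V0 != 0 by rewrite gt_eqF.
have wE : fibre_point v = (dot V V0)^-1 *: V.
  apply: fibre_pointP => //.
  - by rewrite -scalemxAl VT scaler0.
  - by rewrite dotZl mulVf.
  - by rewrite -scalemxAl.
rewrite /unit_fibre_point wE dotZl dotZr VV mulr1 -expr2 sqrtr_sqr.
by rewrite ger0_norm ?invr_ge0 ?ltW// invrK scalerA divff// scale1r.
Qed.

Let unit_fibreP v : dom0 v -> [/\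
  unit_fibre_point v *m (tangent_frame (lsubmx v))^T = 0,
  dot (unit_fibre_point v) (unit_fibre_point v) = 1,
  0 < dot (unit_fibre_point v) V0 & fibre_coord (unit_fibre_point v) = rsubmx v].
Proof.
move=> Dv; have [wT w1 wE] := fibre_point_frame Dv; have w0 := fibre_norm_gt0 Dv.
have s0 : 0 < Num.sqrt (dot (fibre_point v) (fibre_point v)) by rewrite sqrtr_gt0.
split.
- by rewrite /unit_fibre_point -scalemxAl wT scaler0.
- rewrite /unit_fibre_point dotZl dotZr mulrA -expr2 exprVn sqr_sqrtr ?ltW//.
  by rewrite mulVf ?gt_eqF.
- by rewrite /unit_fibre_point dotZl w1 mulr1 invr_gt0.
- rewrite /fibre_coord /unit_fibre_point dotZl w1 mulr1 invrK -scalemxAl wE.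
  by rewrite scalerA divff ?gt_eqF// scale1r.
Qed.

Let fibre_coord_smooth (U : set 'rV[R]_(n + m)) : open U ->
  (forall y, U y -> dot (rsubmx y) V0 != 0) ->
  smooth_on U (fun y => fibre_coord (rsubmx y)).
Proof.
move=> oU U0; apply: smooth_on_scale => //.
  apply: smooth_onV => //; apply: smooth_on_dot oU _ (smooth_on_cst _ _).
  exact: smooth_on_rsubmx.
by apply: smooth_on_mulmx => //; [exact: smooth_on_rsubmx|exact: smooth_on_cst].
Qed.

Lemma bundle_chart_of : chart_of Nstar bundle_chart.
Proof.
have oc : open (cod bundle_chart).
  apply: open_neq0 => // v Dv; apply: smooth_on_continuous Dv.
  apply: smooth_on_normal_hessian open_dom0 (open_cod Mm ab) _ (loc_smooth gi ab)
    (smooth_on_lsubmx _) unit_fibre_smooth.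
  by move=> w [].
have oD := open_bundle ab open_half_space.
split; [|exact: oc| | |].
- by exists [set q : M * 'rV[R]_m | dom b q.1 /\ half_space (row_mx (b q.1) q.2)].
- move=> [p V] [Sq [/= bp]]; rewrite row_mxKl row_mxKr => -[Dp V1].
  have [bc bE] := coordK Mm ab bp; have Nq := Sq.1.
  have VV : dot V V = 1 by have [] := Nq.
  have uE : unit_fibre_point (row_mx (b p) (fibre_coord V)) = V.
    apply: unit_fibreK; rewrite /dom0 /= ?row_mxKl ?row_mxKr//.
    by apply/(tangent_frame_normal _ bc); rewrite bE; exact: bundle_normal Nq.
  have DE : dom0 (row_mx (b p) (fibre_coord V)) by rewrite /dom0 /= row_mxKl.
  split; last by rewrite /= uE row_mxKl bE.
  split; first exact: DE.
  by rewrite /= uE row_mxKl; exact/(star_hessian Mm gi Nq ab bp).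
- move=> v [Dv A0]; have [VT VV V1 VE] := unit_fibreP Dv.
  have [bu du] : frame_dom (lsubmx v) := Dv.
  have [bp bE] := paramK Mm ab bu.
  have Nv : N (param b (lsubmx v), unit_fibre_point v).
    have [Vg Vt] := (tangent_frame_normal (unit_fibre_point v) bu).1 VT.
    by split.
  split; last by rewrite /= bE VE hsubmxK.
  split; first by apply/(star_hessian Mm gi Nv ab bp); rewrite /= bE.
  by rewrite /= row_mxKl row_mxKr bE.
- split.
    apply: (@continuous_subspaceW _ _ _ [set q : M * 'rV[R]_m |
      dom b q.1 /\ half_space (row_mx (b q.1) q.2)]); first by move=> q [].
    rewrite continuous_open_subspace// => q /set_mem[bq Hq].
    apply: (@cvg_row_mx _ _ _ _ (fun r : M * 'rV[R]_m => b r.1)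
      (fun r : M * 'rV[R]_m => fibre_coord r.2)).
      by apply: continuous_comp (coord_cont Mm ab bq); exact: cvg_fst.
    have Fs : smooth_on half_space (fun y => fibre_coord (rsubmx y)).
      by apply: fibre_coord_smooth => // y [_ /lt0r_neq0].
    have -> : (fun r : M * 'rV[R]_m => fibre_coord r.2)
        = (fun y => fibre_coord (rsubmx y)) \o (fun r => row_mx (b r.1) r.2).
      by apply/funext => r /=; rewrite row_mxKr.
    apply: continuous_comp (coord_pair_cont ab bq) _.
    exact: smooth_on_continuous Fs Hq.
  rewrite continuous_open_subspace// => v /set_mem[Dv _].
  have [bu du] : frame_dom (lsubmx v) := Dv.
  have c1 : {for v, continuous (fun s : 'rV[R]_(n + k) => param b (lsubmx s))}.
    have c0 : {for v, continuous (lsubmx : 'rV[R]_(n + k) -> 'rV[R]_n)}.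
      exact: continuous_lsubmx.
    exact: (continuous_comp c0 (param_cont Mm ab bu)).
  have c2 := smooth_on_continuous unit_fibre_smooth Dv.
  exact: (cvg_pair c1 c2).
Qed.

Lemma bundle_chart_submanifold :
  submanifold_charts (n + k) atlas Nstar bundle_chart.
Proof.
split; first exact: bundle_chart_of.
move=> b' ab' U Y.
have oW : open (dom0 `&` lsubmx @^-1` overlap b b').
  apply: (openI open_dom0); apply: open_comp (open_overlap Mm ab ab') => y _.
  exact: continuous_lsubmx.
set W := _ `&` _ in oW.
have UW : U `<=` W by move=> v [[Dv _] b'v]; split=> //; split=> //; exact: Dv.1.
have YW : smooth_on W Y.
  apply: smooth_on_row_mx => //; last first.
    by apply: smooth_on_sub unit_fibre_smooth => v [].
  apply: (smooth_on_comp (phi := lsubmx) oW (open_overlap Mm ab ab') _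
    (smooth_on_lsubmx _) (smooth_transition Mm ab ab')).
  by move=> v [].
split=> [|t /UW Wt]; first exact: smooth_on_sub YW.
pose B : set 'rV[R]_(n + m) := lsubmx @^-1` overlap b' b `&`
  [set y | dot (rsubmx y) V0 != 0].
have oB' : open ((lsubmx : 'rV[R]_(n + m) -> _) @^-1` overlap b' b).
  by apply: open_comp (open_overlap Mm ab' ab) => y _; exact: continuous_lsubmx.
have oB : open B.
  apply: (open_neq0 (F := fun y => dot (rsubmx y) V0) oB') => y.
  apply: smooth_on_continuous.
  exact: smooth_on_dot oB' (smooth_on_rsubmx _) (smooth_on_cst _ _).
(* Psi reads the pair (base point, vector) back in the coordinates of the
   bundle chart: a smooth left inverse of Y. *)
pose Psi (y : 'rV[R]_(n + m)) :=
  row_mx (b (param b' (lsubmx y))) (fibre_coord (rsubmx y)).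
have Psis : smooth_on B Psi.
  apply: smooth_on_row_mx => //; last by apply: fibre_coord_smooth => // y [].
  apply: (smooth_on_comp (phi := lsubmx) oB (open_overlap Mm ab' ab) _
    (smooth_on_lsubmx _) (smooth_transition Mm ab' ab)).
  by move=> v [].
have WB v : W v -> B (Y v) /\ Psi (Y v) = v.
  move=> [Dv [bu b'p]]; have [_ _ V1 VE] := unit_fibreP Dv.
  have [b'c b'E] := coordK Mm ab' b'p; have [bp bE] := paramK Mm ab bu.
  rewrite /B /Psi /Y /= !row_mxKl !row_mxKr b'E bE VE hsubmxK; split=> //.
  split; last by rewrite gt_eqF.
  by split=> //=; rewrite b'E.
apply: (jacobian_left_inverse (Psi := Psi)).
- exact: smooth_on_differentiable YW Wt.
- exact: smooth_on_differentiable Psis (WB _ Wt).1.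
- near=> s; apply: (WB _ _).2; near: s.
  exact: open_nbhs_nbhs (conj oW Wt).
Unshelve. all: by end_near. Qed.

Lemma bundle_chart_dom : dom bundle_chart q0.
Proof.
split=> //; split=> //; rewrite row_mxKl row_mxKr; have [bc _] := coordK Mm ab bq0.
split; first by split=> //=; rewrite -unitfE -unitmxE.
by have [[-> _ _] _] := Sq0.
Qed.

End Frame.
End Chart.

Lemma star_embedded : embedded_submanifold (n + k) atlas Nstar.
Proof.
move=> q Sq; have [b ab bq] := exists_chart Mm q.1.
have [E uE] := exists_frame ab bq Sq.
exists (bundle_chart b q E); first exact: bundle_chart_submanifold.
exact: bundle_chart_dom.
Qed.

End BundleCharts.

(** * Minimality and vanishing curvatures *)

Section GaussMap.
Variables (R : realType) (M : topologicalType).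
Variables (atlas : set (chart R 2 M)) (h : chart R 2 M -> 'rV[R]_2 -> 'M[R]_2).
Variable g : M -> 'rV[R]_6.
Hypotheses (Mm : smooth_manifold atlas) (gi : sphere_immersion setT atlas g).
Hypotheses (giso : isometric atlas h g) (gmin : minimal_immersion atlas h g).

Local Notation Nstar := (unit_normal_bundle_star atlas g).
Local Notation charts := (submanifold_charts 4 atlas Nstar).

(** Smoothness and rank are local, so at each point any chart of M around the base
    point may be used. *)
Lemma gauss_immersion : sphere_immersion Nstar charts (@xg R 6 M).
Proof.
split=> [q [[]] //|c cc|c u cc cu]; last first.
  have [b ab bu] := exists_chart Mm (param c u).1.
  by apply: (gauss_free Mm gi giso gmin cc ab); split.
apply: smooth_on_pt => u cu; have [b ab bu] := exists_chart Mm (param c u).1.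
by apply: smooth_on_sub (gauss_x_smooth Mm cc ab) => _ ->; split.
Qed.

Lemma gauss_curvatures c U nu u : charts c -> U `<=` cod c ->
  unit_normal_field (@xg R 6 M \o param c) U nu -> U u ->
  exists a : R, char_poly (shape_operator (@xg R 6 M \o param c) u (nu u))
    = 'X^2 * ('X^2 - (a ^+ 2)%:P).
Proof.
move=> cc Uc [_ nuU] Uu; have cu := Uc _ Uu; have [nu1 nux nuX] := nuU _ Uu.
have [b ab bu] := exists_chart Mm (param c u).1.
have dx := smooth_on_differentiable (gauss_x_smooth Mm cc ab) (conj cu bu).
apply: (gauss_shape Mm gi giso gmin cc ab (conj cu bu) nu1 nux).
apply/rowP => k; rewrite mulmx_tr_dot row_id [RHS]mxE jacobianE//.
by rewrite deriveE//; exact: nuX.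
Qed.

End GaussMap.

Theorem theorem2p2 (R : realType) (M : topologicalType)
    (atlas : set (chart R 2 M)) (h : chart R 2 M -> 'rV[R]_2 -> 'M[R]_2)
    (g : M -> 'rV[R]_6)
    (M_manifold : smooth_manifold atlas)
    (h_metric : riemannian_metric atlas h)
    (g_immersion : sphere_immersion setT atlas g)
    (g_isometric : isometric atlas h g)
    (g_minimal : minimal_immersion atlas h g)
    (B_neq0 : forall p : M, exists2 w, second_form_values atlas g p w & w != 0) :
  let N := unit_normal_bundle atlas g in
  let Nstar := unit_normal_bundle_star atlas g in
  let charts := submanifold_charts 4 atlas Nstar in
  [/\ exists2 O : set (M * 'rV[R]_6), open O & Nstar = N `&` O,
      embedded_submanifold 4 atlas Nstar,
      sphere_immersion Nstar charts (@xg R 6 M) &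
      forall (c : chart R 4 (M * 'rV[R]_6)%type) (U : set 'rV[R]_4)
             (nu : 'rV[R]_4 -> 'rV[R]_6),
        charts c -> open U -> U `<=` cod c ->
        unit_normal_field (@xg R 6 M \o param c) U nu ->
        forall u, U u ->
          [/\ r_mean_curvature (@xg R 6 M \o param c) u (nu u) 1 0,
              r_mean_curvature (@xg R 6 M \o param c) u (nu u) 4 0 &
              r_mean_curvature (@xg R 6 M \o param c) u (nu u) 3 0]].
Proof.
split.
- exact: (@star_open R 2 2 M atlas g M_manifold g_immersion).
- exact: (@star_embedded R 2 2 M atlas g M_manifold g_immersion).
- exact: gauss_immersion M_manifold g_immersion g_isometric g_minimal.
- move=> c U nu cc _ Uc nuU u Uu.
  have [a aE] := gauss_curvatures M_manifold g_immersion g_isometric g_minimal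
    cc Uc nuU Uu.
  split; first exact: r_mean_curvature1 aE.
    exact: r_mean_curvature_ge3 aE _ _.
  exact: r_mean_curvature_ge3 aE _ _.
Qed.
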